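(* Let $\mathcal{R}=\{(\xi(C),\psi(C)) : C\in\mathcal{C}\}\subseteq[0,1]\times[-\frac12,1]$. Then $\mathcal{R}$ is convex and closed. Moreover, every $(x,y)\in\mathcal{R}$ satisfies $y\le\sqrt{x}$, and if in addition $y\le 0$, then $x\ge \Xi(\mu(y))$, where $\mu(y)$ is the unique solution in $[0,2]$ of the cubic equation $\mu^3-(4+2y)\mu^2-(4+8y)\mu-8y=0$ and, with $v_1=\frac{2}{2+\mu}$, \[ \Xi(\mu)=-4v_1^2+20v_1-17+\frac{2}{v_1}-\frac{1}{v_1^2}-12\ln(v_1). \]
   Context: $\mathcal{C}$ is the set of bivariate copulas; $\xi(C)=6\int_0^1\int_0^1(\partial_1C(u,v))^2\,du\,dv-2$, $\psi(C)=6\int_0^1C(u,u)\,du-2$. (Here $\Xi(\mu)=\xi(C^{\searrow}_\mu)$ for the explicit function family of the lower boundary estimate; $\mu(y)$ is characterized by $-2v_1^2+6v_1-5+1/v_1=y$ with $v_1=2/(2+\mu(y))$.) *)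

(* Defs.v *)
From HB Require Import structures.
From mathcomp Require Import all_boot all_order all_algebra.
From mathcomp Require Import all_classical all_reals all_analysis.
Set Implicit Arguments. Unset Strict Implicit. Unset Printing Implicit Defensive.
Import Order.TTheory GRing.Theory Num.Theory.
Import numFieldNormedType.Exports.
Local Open Scope classical_set_scope.
Local Open Scope ring_scope.

Section Copulas.
Variable R : realType.

(* A bivariate copula: a function [0,1]^2 -> R (represented as R -> R -> R,
   values outside [0,1]^2 irrelevant) that is grounded, has uniform margins
   and is 2-increasing. *)
Definition is_copula (C : R -> R -> R) : Prop :=
  (forall u, 0 <= u <= 1 -> C u 0 = 0 /\ C 0 u = 0 /\ C u 1 = u /\ C 1 u = u) /\
  (forall u1 u2 v1 v2, 0 <= u1 -> u1 <= u2 -> u2 <= 1 ->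
                       0 <= v1 -> v1 <= v2 -> v2 <= 1 ->
     0 <= C u2 v2 - C u2 v1 - C u1 v2 + C u1 v1).

Definition d1 (C : R -> R -> R) (u v : R) : R := derive1 (fun w => C w v) u.

Definition xi (C : R -> R -> R) : R :=
  6 * (\int[@lebesgue_measure R]_(v in `[0, 1]%classic)
         (\int[@lebesgue_measure R]_(u in `[0, 1]%classic) (d1 C u v ^+ 2))) - 2.

Definition psi (C : R -> R -> R) : R :=
  6 * (\int[@lebesgue_measure R]_(u in `[0, 1]%classic) C u u) - 2.

Definition xi_psi_region : set (R * R) :=
  [set p | exists C, is_copula C /\ p = (xi C, psi C)].

Definition mu_cubic (y m : R) : R :=
  m ^+ 3 - (4 + 2 * y) * m ^+ 2 - (4 + 8 * y) * m - 8 * y.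

Definition Xi (m : R) : R :=
  let v1 := 2 / (2 + m) in
  - 4 * v1 ^+ 2 + 20 * v1 - 17 + 2 / v1 - 1 / v1 ^+ 2 - 12 * ln v1.

End Copulas.

(* Main.v *)
Require Import Defs.
From HB Require Import structures.
From mathcomp Require Import all_boot all_order all_algebra.
From mathcomp Require Import all_classical all_reals all_analysis.
From mathcomp Require Import measurable_realfun.
From mathcomp Require Import ring lra.
Import Order.TTheory GRing.Theory Num.Theory.
Import numFieldNormedType.Exports.
Local Open Scope classical_set_scope.
Local Open Scope ring_scope.

(* Write [G v] for [\int (d1 C u v)^2 du], so that [xi C + 2 = 6 \int G]. The map
   [u |-> C u v] is nondecreasing and 1-Lipschitz, so its Stieltjes measure is
   dominated by the Lebesgue measure; Radon-Nikodym and Lebesgue differentiation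
   show that it is the primitive of its derivative [f], with [0 <= f <= 1].
   Integrating [0 <= (f - s)^2] for step functions [s] bounds [G v] from below by
   affine functions of [C v v]. Optimal choices of [s] give [psi^2 <= xi] and,
   with the two constraints [0 <= f <= 1] active near [v = 0] and [v = 1], the
   bound by [Xi]. Along the segment between two copulas [psi] is affine and [xi]
   is a convex quadratic. Since every value of [psi] is attained by a shuffle with
   [xi = 1], mixing with shuffles shows that the region contains, with each
   point, the horizontal segment up to [x = 1]; convexity follows at once. For
   closedness, an ultrafilter limit of copulas is a uniform limit, under which
   [psi] is continuous, and [xi] is lower semicontinuous because [G] is the
   supremum of the energies of the difference quotients in [u]. *)

(** * Densities of monotone 1-Lipschitz functions on the line *)

Section density.
Context {R : realType}.
Local Notation mu := (@lebesgue_measure R).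

Lemma lebesgue_stieltjes_measure_itvoc (F : cumulative R R) (a b : R) :
  a <= b -> lebesgue_stieltjes_measure F `]a, b]%classic = (F b - F a)%:E.
Proof.
move=> ab; rewrite /lebesgue_stieltjes_measure /measure_extension.
rewrite measurable_mu_extE/=; last exact: is_ocitv.
by rewrite wlength_itv_bnd.
Qed.

Lemma aeS (P Q : R -> Prop) : (forall x, P x -> Q x) ->
  {ae mu, forall x, P x} -> {ae mu, forall x, Q x}.
Proof. by move=> PQ; apply: filterS PQ; exact: (ae_filter_ringOfSetsType mu). Qed.

Lemma aeS2 (P Q S : R -> Prop) : (forall x, P x -> Q x -> S x) ->
  {ae mu, forall x, P x} -> {ae mu, forall x, Q x} -> {ae mu, forall x, S x}.
Proof. by move=> PQ; apply: filterS2 PQ; exact: (ae_filter_ringOfSetsType mu). Qed.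

Definition slope01 (F : R -> R) :=
  forall x y, x <= y -> 0 <= F y - F x <= y - x.

Lemma slope01_continuous F : slope01 F -> continuous F.
Proof.
move=> sF x; apply/cvgrPdist_le => e e0.
near=> y.
have : `|x - y| <= e.
  near: y; have := @cvgr_dist_le _ _ _ _ _ idfun x cvg_id e e0. exact.
rewrite !ler_norml.
by have [xy|/ltW yx] := leP x y; [have := sF _ _ xy|have := sF _ _ yx]; lra.
Unshelve. all: by end_near. Qed.

Lemma slope01_compl F : slope01 F -> slope01 (fun x => x - F x).
Proof. by move=> sF x y xy; have := sF _ _ xy; lra. Qed.

Lemma slope01_cumulative F : slope01 F -> exists cF : cumulative R R, F = cF.
Proof.
move=> sF.
have nd : nondecreasing F by move=> x y /sF; rewrite subr_ge0 => /andP[].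
have rc : right_continuous F by exact/right_continuousW/slope01_continuous.
pose cF : cumulative R R := HB.pack F (isCumulative.Build R _ R F nd rc).
by exists cF.
Qed.

(** The complement [x - F x] has the same slope bounds, and the Stieltjes measures of the two
    functions add up to Lebesgue measure, as they do on half-open intervals. *)
Lemma slope01_stieltjes_le (F : cumulative R R) : slope01 F ->
  forall A, measurable A -> (lebesgue_stieltjes_measure F A <= mu A)%E.
Proof.
move=> sF A mA; have [G GE] := slope01_cumulative _ (slope01_compl _ sF).
rewrite (@lebesgue_measure_unique R (measure_add (lebesgue_stieltjes_measure F)
  (lebesgue_stieltjes_measure G)))//; last first.
  move=> _ [[a b] _ <-]; rewrite [RHS]measure_addE /=.
  have [ab|ba] := leP a b; last first.
    by rewrite set_itv_ge ?measure0 ?adde0 // bnd_simp -leNgt ltW.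
  rewrite !lebesgue_stieltjes_measure_itvoc// lebesgue_measure_itv/= lte_fin.
  rewrite -EFinD -GE; case: ltP => ab'; first by rewrite -EFinD; congr EFin; ring.
  have -> : a = b by apply/le_anti; rewrite ab.
  by congr EFin; ring.
by rewrite [leRHS]measure_addE leeDl.
Qed.

(** Restricting to the steps [1 / (n + 1)] turns the derivative into a limit of a sequence, as
    dominated convergence requires. *)
Lemma is_derive_seq (F : R -> R) (x d : R) : is_derive x 1 F d ->
  n.+1%:R * (F (x + n.+1%:R^-1) - F x) @[n --> \oo] --> d.
Proof.
move=> [dF <-].
have h : forall n, @harmonic R n != 0 by move=> n; rewrite gt_eqF// harmonic_gt0.
have := (cvgr_dnbhsP _ _ _).1 dF _ (conj h cvg_harmonic).
apply: cvg_trans; apply: near_eq_cvg; apply: nearW => n /=.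
by rewrite invrK; congr (_ * (F _ - _)); rewrite addrC; congr (_ + _); exact: mulr1.
Qed.

Lemma is_derive_ge0 (F : R -> R) (x d : R) :
  {homo F : x y / x <= y} -> is_derive x 1 F d -> 0 <= d.
Proof.
move=> ndF /is_derive_seq dF; apply: cvgr_to_ge dF _; apply: nearW => n.
by rewrite mulr_ge0// subr_ge0 ndF// lerDl.
Qed.

Lemma slope01_derive F (x d : R) : slope01 F -> is_derive x 1 F d ->
  0 <= d <= 1.
Proof.
move=> sF dF; apply/andP; split.
  by apply: is_derive_ge0 dF => a b /sF; rewrite subr_ge0 => /andP[].
rewrite -subr_ge0; apply: (@is_derive_ge0 (fun x => x - F x) x).
  by move=> a b /sF; lra.
Qed.

(** The density is the Radon-Nikodym derivative of the Stieltjes measure of [F]; Lebesgue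
    differentiation of its primitive identifies it almost everywhere with the derivative of [F]. *)
Lemma slope01_density F : slope01 F ->
  (forall x, x <= 0 -> F x = F 0) -> (forall x, 1 <= x -> F x = F 1) ->
  exists f : R -> R, [/\ measurable_fun setT f, forall x, 0 <= f x <= 1,
    {ae mu, forall x : R, is_derive x 1 F (f x)} &
    forall p q, p <= q -> \int[mu]_(x in `[p, q]) f x = F q - F p].
Proof.
move=> sF F0 F1; have [cF FE] := slope01_cumulative _ sF.
(* Cutting down to a bounded interval makes the measure finite and loses no mass, since [F] is
   constant outside [0, 1]. *)
pose D : set (measurableTypeR R) := `]-1, 2]%classic.
have mD : measurable D by exact: measurable_itv.
pose ls : {measure set (measurableTypeR R) -> \bar R} :=
  lebesgue_stieltjes_measure cF.
have moo : (ls D < +oo)%E.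
  have -> : ls D = (cF 2 - cF (-1))%:E.
    by apply: lebesgue_stieltjes_measure_itvoc; lra.
  exact: ltry.
pose nu : {finite_measure set (measurableTypeR R) -> \bar R} := mfrestr mD moo.
have numu : (charge_of_finite_measure nu) `<< mu.
  apply/null_content_dominatesP => A mA muA0.
  apply/eqP; rewrite -measure_le0; rewrite /nu /= /mfrestr /mrestr.
  have := @slope01_stieltjes_le cF; rewrite -FE => /(_ sF A mA); rewrite muA0.
  by apply: le_trans; apply: le_measure; rewrite ?inE//; exact: measurableI.
pose g := Radon_Nikodym (charge_of_finite_measure nu) mu.
have ig : mu.-integrable setT g by exact: Radon_Nikodym_integrable.
pose g0 : R -> R := fine \o g.
have gE : g = EFin \o g0.
  by apply/funext => x; rewrite /g0 /= fineK// Radon_Nikodym_fin_num.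
have ig0 : mu.-integrable [set: R] (EFin \o g0) by rewrite -gE.
have ig0' (A : set R) : measurable A -> mu.-integrable A (EFin \o g0).
  by move=> mA; apply: integrableS ig0.
have mg0 : measurable_fun setT g0 by move/integrableP : ig0 => [/measurable_EFinP].
have H x : \int[mu]_(t in `]-oo, x]) g0 t = F x - F (-1).
  rewrite /Rintegral.
  under eq_integral do rewrite -[(g0 _)%:E]/((EFin \o g0) _) -gE.
  rewrite -Radon_Nikodym_integral// /nu /charge_of_finite_measure /=.
  rewrite /mfrestr /mrestr.
  have [x1|x1] := ltP x (-1).
    rewrite (_ : _ `&` _ = set0) ?measure0 /=; last first.
      rewrite -subset0 => t []; rewrite /D /= !in_itv/= => tx /andP[t1 _].
      by have := lt_trans (lt_le_trans t1 tx) x1; rewrite ltxx.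
    by rewrite !F0 ?subrr//; lra.
  rewrite (_ : _ `&` _ = `]-1, Num.min x 2]%classic); last first.
    apply/seteqP; split => t; rewrite /D /= !in_itv/= le_min.
      by move=> [-> ->].
    by case/andP => -> /andP[-> ->].
  have -> : ls `]-1, Num.min x 2]%classic = (F (Num.min x 2) - F (-1))%:E.
    by rewrite FE; apply: lebesgue_stieltjes_measure_itvoc; rewrite le_min x1; lra.
  by case: leP => // x2; rewrite (F1 x) ?(F1 2)//; lra.
have ae1 : {ae mu, forall x : R, is_derive x 1 F (g0 x)}.
  have lg0 : locally_integrable setT g0.
    by have := integrable_locally measurableT ig0; rewrite patch_setT.
  have := @FTC1Ny R g0 (fun y => ig0' _ (measurable_itv _)) lg0.
  rewrite (_ : (fun x : R => _) = F - cst (F (-1))); last first.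
    by apply/funext => x; rewrite H.
  apply: aeS => x [dH HE].
  have -> : F = (F - cst (F (-1))) + cst (F (-1)) by rewrite subrK.
  rewrite -HE derive1E -[X in is_derive _ _ _ X]addr0.
  by apply: is_deriveD; exact: derivableP.
(* The Radon-Nikodym derivative is known to lie in [0, 1] only almost everywhere; truncation makes
   this hold everywhere and changes it on a null set only. *)
pose f x := Num.max 0 (Num.min 1 (g0 x)).
have mf : measurable_fun setT f.
  by apply: measurable_maxr => //; apply: measurable_minr.
have f01 x : 0 <= f x <= 1.
  by rewrite /f le_max lexx ge_max ler01 ge_min lexx.
have aefg : {ae mu, forall x, g0 x = f x}.
  apply: aeS ae1 => x /(slope01_derive _ _ _ sF).
  by case/andP => ? ?; rewrite /f min_r// max_r.
exists f; split => //.
  by apply: aeS2 ae1 aefg => x + <-.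
move=> p q pq.
transitivity (\int[mu]_(x in `[p, q]) g0 x).
  congr fine; apply: ae_eq_integral => //.
  - by apply/measurable_EFinP; apply: measurable_funS mf.
  - by apply/measurable_EFinP; apply: measurable_funS mg0.
  - by apply: aeS aefg => x -> _.
rewrite -Rintegral_itv_obnd_cbnd//; last exact: ig0'.
rewrite -(@Rintegral_itvB _ _ -oo%O (BRight q)) ?bnd_simp//; last exact: ig0'.
by rewrite !H; ring.
Qed.

End density.

(** * Almost everywhere equality without measurability of one side *)

Section ae_ge0.
Import HBNNSimple.

(* [g] may be non-measurable: the Lebesgue integral of a nonnegative
   function is a supremum over the simple functions below it. *)
Lemma ae_ge0_eq_Rintegral {d} {T : measurableType d} {R : realType}
    (mu : {measure set T -> \bar R}) (D : set T) (f g : T -> R) :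
  measurable D ->
  measurable_fun D f -> (forall x, 0 <= f x) -> (forall x, 0 <= g x) ->
  {ae mu, forall x, D x -> f x = g x} ->
  \int[mu]_(x in D) f x = \int[mu]_(x in D) g x.
Proof.
move=> mD mf f0 g0 [N [mN N0 fgN]]; congr fine.
(* Monotonicity holds without measurability: simple functions below [h] are also below [k]. *)
have mono (h k : T -> \bar R) : (forall x, 0 <= h x)%E ->
    (forall x, h x <= k x)%E -> (\int[mu]_x h x <= \int[mu]_x k x)%E.
  move=> h0 hk; rewrite !ge0_integralTE//; last first.
    by move=> x; exact: le_trans (h0 x) (hk x).
  by apply: ereal_sup_le => _ [s sh <-]; exists s => // x; exact: le_trans (sh x) (hk x).
have gE : (\int[mu]_(x in D) (g x)%:E = \int[mu]_x ((EFin \o g) \_ D) x)%E.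
  by rewrite integral_mkcond.
have gD0 x : (0 <= ((EFin \o g) \_ D) x)%E.
  by rewrite patchE; case: ifP => //= _; rewrite lee_fin.
have fgE x : D x -> ~ N x -> f x = g x.
  by move=> Dx; apply: contra_notP => fg; apply: fgN => /=; apply: contra_not fg; exact.
have mDN : measurable (D `\` N) by exact: measurableD.
have fE : (\int[mu]_(x in D) (f x)%:E = \int[mu]_(x in D `\` N) (f x)%:E)%E.
  apply: ge0_negligible_integral => //; first exact/measurable_EFinP.
  by move=> x _; rewrite lee_fin; exact: f0.
apply/le_anti/andP; split.
  rewrite fE gE integral_mkcond; apply: mono => x; rewrite !patchE.
    by case: ifP => //= _; rewrite lee_fin.
  case: ifPn => [|_]; last by case: ifP => //= _; rewrite lee_fin.
  by rewrite inE => -[Dx Nx]; rewrite mem_set//= fgE.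
(* A simple function below [g] is below [f] off the null set [N], and discarding [N] does not change
   its integral. *)
rewrite gE ge0_integralTE//; apply: ge_ereal_sup => _ [s sg <-].
rewrite -integralT_nnsfun (ge0_negligible_integral mN)//; last 2 first.
  exact/measurable_EFinP.
  by move=> x _; rewrite lee_fin.
rewrite fE [leRHS]integral_mkcond [leLHS]integral_mkcond.
apply: mono => x; rewrite !patchE; first by case: ifPn => // _; rewrite lee_fin.
have [Nx|Nx] := pselect (N x).
  rewrite memNset; last by case.
  by case: ifP => // _; rewrite lee_fin.
rewrite mem_set//; have := sg x; rewrite patchE.
have [Dx|Dx] := pselect (D x); first by rewrite (mem_set Dx) mem_set//= fgE.
by rewrite !memNset// => -[].
Qed.

End ae_ge0.

(** * Linear operations on integrable real functions *)

Section Rintegrable.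
Context {d} {T : measurableType d} {R : realType} {mu : {measure set T -> \bar R}}.
Context {D : set T} (mD : measurable D).
Implicit Types f g : T -> R.

Lemma RintegrableZ (k : R) f : mu.-integrable D (EFin \o f) ->
  mu.-integrable D (EFin \o (fun x => k * f x)).
Proof. by move=> fi; apply: eq_integrable (integrableZl mD k fi). Qed.

Lemma RintegrableD f g :
  mu.-integrable D (EFin \o f) -> mu.-integrable D (EFin \o g) ->
  mu.-integrable D (EFin \o (fun x => f x + g x)).
Proof. by move=> fi gi; apply: eq_integrable (integrableD mD fi gi). Qed.

Lemma RintegrableB f g :
  mu.-integrable D (EFin \o f) -> mu.-integrable D (EFin \o g) ->
  mu.-integrable D (EFin \o (fun x => f x - g x)).
Proof. by move=> fi gi; apply: eq_integrable (integrableB mD fi gi). Qed.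

End Rintegrable.

(** * Integration over compact intervals *)

Section integrals.
Context {R : realType}.
Local Notation mu := (@lebesgue_measure R).

Lemma bounded_integrable (a b M : R) (f : R -> R) :
  measurable_fun `[a, b] f -> (forall x, a <= x <= b -> `|f x| <= M) ->
  mu.-integrable `[a, b] (EFin \o f).
Proof.
move=> mf fM; apply: measurable_bounded_integrable => //.
  rewrite /= lebesgue_measure_itv/=; case: ifPn => _; last exact: ltry.
  by rewrite -EFinD ltry.
exists M; split; first exact: num_real.
by move=> N MN x /=; rewrite in_itv/= => /fM fxM; exact: le_trans fxM (ltW MN).
Qed.

Lemma continuous_integrable (a b : R) (f : R -> R) :
  (forall x, a <= x <= b -> {for x, continuous f}) ->
  mu.-integrable `[a, b] (EFin \o f).
Proof.
move=> cf; apply: continuous_compact_integrable; first exact: segment_compact.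
by apply: continuous_in_subspaceT => x; rewrite inE/= in_itv/=; exact: cf.
Qed.

Lemma Rintegral_split (a c b : R) (f : R -> R) : a <= c <= b ->
  mu.-integrable `[a, b] (EFin \o f) ->
  \int[mu]_(x in `[a, b]) f x =
  \int[mu]_(x in `[a, c]) f x + \int[mu]_(x in `[c, b]) f x.
Proof.
move=> /andP[ac cb] fi.
rewrite -[X in _ = _ + X]Rintegral_itv_obnd_cbnd; last first.
  by apply: integrableS fi => //; apply: subset_itv; rewrite bnd_simp.
by rewrite -(@Rintegral_itvB _ _ (BLeft a) (BRight b)) ?bnd_simp//; ring.
Qed.

Lemma Rintegral_itv_cst (a b k : R) : a <= b ->
  \int[mu]_(x in `[a, b]) k = k * (b - a).
Proof.
move=> ab; rewrite Rintegral_cst//= lebesgue_measure_itv/= lte_fin.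
case: ltP => // ba; have -> : a = b by apply/le_anti; rewrite ab.
by rewrite subrr.
Qed.

Lemma FTC2_is_derive (a b : R) (F f : R -> R) : a <= b ->
  (forall x, a <= x <= b -> is_derive x 1 F (f x)) ->
  (forall x, a <= x <= b -> {for x, continuous f}) ->
  \int[mu]_(x in `[a, b]) f x = F b - F a.
Proof.
rewrite le_eqVlt => /predU1P[<- _ _|ab dF cf].
  by rewrite set_itv1 Rintegral_set1 subrr.
rewrite /Rintegral (@continuous_FTC2 _ f F)//.
- by apply: continuous_in_subspaceT => x; rewrite inE/= in_itv/=; exact: cf.
- split.
  + move=> x; rewrite in_itv/= => /andP[ax xb].
    by apply: (@ex_derive _ _ _ _ _ _ _ (dF x _)); rewrite !ltW.
  + apply: cvg_at_right_filter.
    apply: differentiable_continuous; apply/derivable1_diffP.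
    by apply: (@ex_derive _ _ _ _ _ _ _ (dF a _)); rewrite lexx ltW.
  + apply: cvg_at_left_filter.
    apply: differentiable_continuous; apply/derivable1_diffP.
    by apply: (@ex_derive _ _ _ _ _ _ _ (dF b _)); rewrite lexx ltW.
- move=> x; rewrite in_itv/= => /andP[ax xb]; rewrite derive1E.
  by apply: (@derive_val _ _ _ _ _ _ _ (dF x _)); rewrite !ltW.
Qed.

(** Extended by its endpoint values, the function is monotone on the whole line. *)
Lemma nondecreasing_in_measurable (a b : R) (f : R -> R) :
  (forall x y, a <= x -> x <= y -> y <= b -> f x <= f y) ->
  measurable_fun `[a, b] f.
Proof.
move=> ndf; have [ab|ba] := leP a b; last first.
  rewrite set_itv_ge ?bnd_simp -?ltNge//; exact: measurable_fun_set0.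
apply: (@eq_measurable_fun _ _ _ _ _ (fun x => f (Num.max a (Num.min b x)))).
  move=> x; rewrite inE/= in_itv/= => /andP[ax xb].
  by rewrite min_r// max_r.
apply: nondecreasing_measurable => // x y xy; apply: ndf.
- by rewrite le_max lexx.
- by rewrite ge_max !le_max lexx /= le_min !ge_min lexx /= xy !orbT.
- by rewrite ge_max ab ge_min lexx.
Qed.

Lemma ae_neq (a : R) : {ae mu, forall x, x != a}.
Proof.
exists [set a]; split; [exact: measurable_set1|exact: lebesgue_measure_set1|].
by move=> x /negP; rewrite negbK => /eqP.
Qed.

End integrals.

(* Locked, so that unification never compares two energies by unfolding integrals. *)
HB.lock Definition d1_energy {R : realType} (C : R -> R -> R) (v : R) : R :=
  \int[@lebesgue_measure R]_(u in `[0, 1]%classic) (d1 C u v ^+ 2).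

HB.lock Definition energy {R : realType} (C : R -> R -> R) : R :=
  \int[@lebesgue_measure R]_(v in `[0, 1]%classic) d1_energy C v.

(** * Sections of a copula: their densities and bounds on their energy *)

Section copulas.
Context {R : realType}.
Local Notation mu := (@lebesgue_measure R).
Implicit Types (C D : R -> R -> R) (u v p q l : R) (f g : R -> R).

Definition clamp (x : R) := Num.max 0 (Num.min 1 x).

Lemma clamp01 x : 0 <= clamp x <= 1.
Proof. by rewrite /clamp le_max lexx ge_max ler01 ge_min lexx. Qed.

Lemma clamp_id x : 0 <= x <= 1 -> clamp x = x.
Proof. by case/andP => x0 x1; rewrite /clamp min_r// max_r. Qed.

Lemma clamp_le0 x : x <= 0 -> clamp x = 0.
Proof. by move=> x0; rewrite /clamp max_l// ge_min x0 orbT. Qed.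

Lemma clamp_ge1 x : 1 <= x -> clamp x = 1.
Proof. by move=> x1; rewrite /clamp min_l// max_r. Qed.

Lemma clamp_slope01 : slope01 clamp.
Proof.
move=> x y xy; have [x0|x0] := leP x 0; have [y1|y1] := leP 1 y.
- by rewrite (clamp_le0 x)// (clamp_ge1 y)//; apply/andP; split; lra.
- rewrite (clamp_le0 x)//; have [y0|y0] := leP y 0.
    by rewrite clamp_le0//; apply/andP; split; lra.
  by rewrite clamp_id; apply/andP; split; lra.
- rewrite (clamp_ge1 y)//; have [x1|x1] := leP 1 x.
    by rewrite clamp_ge1//; apply/andP; split; lra.
  by rewrite clamp_id; apply/andP; split; lra.
- by rewrite !clamp_id; apply/andP; split; lra.
Qed.

(** The two bounds are the nonnegative masses of the rectangles over [[u1, u2]] below and above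
    height [v]. *)
Lemma copula_slope_u C u1 u2 v : is_copula C -> 0 <= u1 -> u1 <= u2 -> u2 <= 1 ->
  0 <= v <= 1 -> 0 <= C u2 v - C u1 v <= u2 - u1.
Proof.
move=> [Cb C2] u10 u12 u21 /andP[v0 v1].
have h1 : 0 <= u1 <= 1 by rewrite u10 (le_trans u12).
have h2 : 0 <= u2 <= 1 by rewrite u21 (le_trans u10).
have [a1 [_ [b1 _]]] := Cb _ h1; have [a2 [_ [b2 _]]] := Cb _ h2.
have l := C2 _ _ _ _ u10 u12 u21 (lexx 0) v0 v1.
have r := C2 _ _ _ _ u10 u12 u21 v0 v1 (lexx 1).
by apply/andP; split; lra.
Qed.

Lemma copula_slope_v C u v1 v2 : is_copula C -> 0 <= v1 -> v1 <= v2 -> v2 <= 1 ->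
  0 <= u <= 1 -> 0 <= C u v2 - C u v1 <= v2 - v1.
Proof.
move=> [Cb C2] v10 v12 v21 /andP[u0 u1].
have h1 : 0 <= v1 <= 1 by rewrite v10 (le_trans v12).
have h2 : 0 <= v2 <= 1 by rewrite v21 (le_trans v10).
have [_ [a1 [_ b1]]] := Cb _ h1; have [_ [a2 [_ b2]]] := Cb _ h2.
have l := C2 _ _ _ _ (lexx 0) u0 u1 v10 v12 v21.
have r := C2 _ _ _ _ u0 u1 (lexx 1) v10 v12 v21.
by apply/andP; split; lra.
Qed.

(** The Fréchet-Hoeffding bounds, read off from the slope bounds between the point and the sides of
    the square. *)
Lemma copula_bounds C u v : is_copula C -> 0 <= u <= 1 -> 0 <= v <= 1 ->
  [/\ 0 <= C u v, u + v - 1 <= C u v, C u v <= u & C u v <= v].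
Proof.
move=> cC u01 v01; have [Cb _] := cC.
have [_ [a1 [_ b1]]] := Cb _ v01; have [a2 [_ [b2 _]]] := Cb _ u01.
case/andP: (u01) => u0 u1; case/andP: (v01) => v0 v1.
have := copula_slope_u _ _ _ _ cC (lexx 0) u0 u1 v01.
have := copula_slope_u _ _ _ _ cC u0 u1 (lexx 1) v01.
have := copula_slope_v _ _ _ _ cC (lexx 0) v0 v1 u01.
by split; lra.
Qed.

(** [C] is arbitrary outside the unit square; clamping yields a function on the line that is
    constant outside [0, 1], as [slope01_density] asks. *)
Definition usection C v u := C (clamp u) v.

Lemma usection_slope01 C v : is_copula C -> 0 <= v <= 1 ->
  slope01 (usection C v).
Proof.
move=> cC v01 x y xy; have := clamp_slope01 _ _ xy.
have /andP[x0 x1] := clamp01 x; have /andP[y0 y1] := clamp01 y.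
rewrite subr_ge0 => /andP[cxy ?].
have /andP[? ?] := copula_slope_u _ _ _ _ cC x0 cxy y1 v01.
by rewrite /usection; apply/andP; split; lra.
Qed.

(** [d1 C] agrees with [f] almost everywhere on [0, 1] but is not known to be measurable, hence the
    appeal to [ae_ge0_eq_Rintegral]. *)
Lemma d1_energyE C v f : measurable_fun setT f ->
  {ae mu, forall u : R, is_derive u 1 (usection C v) (f u)} ->
  d1_energy C v = \int[mu]_(u in `[0, 1]) (f u ^+ 2).
Proof.
move=> mf df; rewrite d1_energy.unlock; apply/esym/ae_ge0_eq_Rintegral => //.
- by apply: measurable_funX; exact: measurable_funS mf.
- by move=> x; exact: sqr_ge0.
- by move=> x; exact: sqr_ge0.
(* At the endpoints [d1 C] sees values of [C] outside the square while [usection] sees clamped ones,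
   so only interior points can be compared. *)
have : {ae mu, forall x : R, x != 0 /\ x != 1}.
  by apply: aeS2 (ae_neq 0) (ae_neq 1) => x.
apply: aeS2 df => u dfu [u0 u1] /=; rewrite in_itv/= => /andP[u0' u1'].
congr (_ ^+ 2); rewrite /d1 derive1E.
have : is_derive u 1 (fun w => C w v) (f u).
  apply: near_eq_is_derive dfu.
  have ou : u \in `]0, 1[ by rewrite in_itv/= !lt_neqAle u0' u1' eq_sym u0 u1.
  near=> w; rewrite /usection clamp_id//.
  have /andP[? ?] : 0 < w < 1.
    by near: w; have := near_in_itvoo ou; apply: filterS => w; rewrite in_itv.
  by rewrite !ltW.
by move=> /@derive_val ->.
Unshelve. all: by end_near. Qed.

Definition is_density C v f :=
  [/\ measurable_fun setT f, forall u, 0 <= f u <= 1,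
    {ae mu, forall u : R, is_derive u 1 (usection C v) (f u)} &
    forall p q, 0 <= p -> p <= q -> q <= 1 ->
      \int[mu]_(u in `[p, q]) f u = C q v - C p v].

Lemma density_ex C v : is_copula C -> 0 <= v <= 1 -> exists f, is_density C v f.
Proof.
move=> cC v01.
have [|x x0|x x1|f [mf f01 df If]] := @slope01_density R (usection C v).
- exact: usection_slope01.
- by rewrite /usection !clamp_le0.
- by rewrite /usection !clamp_ge1.
exists f; split => // p q p0 pq q1.
by rewrite If// /usection !clamp_id// ?p0 ?q1 ?(le_trans p0) ?(le_trans pq).
Qed.

Section density.
Context {C v f} (cC : is_copula C) (v01 : 0 <= v <= 1) (df : is_density C v f).

Lemma density_int p q : mu.-integrable `[p, q] (EFin \o f).
Proof.
case: df => mf f01 _ _; apply: (@bounded_integrable _ _ _ 1).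
  exact: measurable_funS mf.
by move=> x _; have /andP[? ?] := f01 x; rewrite ger0_norm.
Qed.

Lemma density_sqr_int p q : mu.-integrable `[p, q] (EFin \o (fun u => f u ^+ 2)).
Proof.
case: df => mf f01 _ _; apply: (@bounded_integrable _ _ _ 1).
  by apply: measurable_funX; exact: measurable_funS mf.
move=> x _; have /andP[? ?] := f01 x.
by rewrite ger0_norm ?sqr_ge0// expr_le1.
Qed.

Lemma density_energy : d1_energy C v = \int[mu]_(u in `[0, 1]) (f u ^+ 2).
Proof. by case: df => mf _ ? _; exact: d1_energyE. Qed.

(* Integrate [0 <= (f - s)^2]. *)
Lemma density_tangent p q s : 0 <= p -> p <= q -> q <= 1 ->
  2 * s * (C q v - C p v) - s ^+ 2 * (q - p) <=
  \int[mu]_(u in `[p, q]) (f u ^+ 2).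
Proof.
move=> p0 pq q1; case: df => mf f01 _ If; rewrite -If// -Rintegral_itv_cst//.
have ci (k : R) : mu.-integrable `[p, q] (EFin \o cst k).
  by apply: continuous_integrable => x _; exact: cvg_cst.
rewrite -RintegralZl//; last exact: density_int.
have fi : mu.-integrable `[p, q] (EFin \o (fun u => 2 * s * f u)).
  by apply: RintegrableZ => //; exact: density_int.
rewrite -RintegralB//; last exact: ci.
apply: le_Rintegral => //; [by apply: RintegrableB => //; exact: ci|exact: density_sqr_int|].
by move=> u _; have := sqr_ge0 (f u - s); nra.
Qed.

(** [density_tangent] with slope [a] on [[0, p]] and [b] on [[p, 1]]. At [p = v] this bounds the
    energy below by an affine function of the diagonal value [C v v]. *)
Lemma energy_ge2 p a b : 0 <= p <= 1 ->
  2 * a * C p v + 2 * b * (v - C p v) - a ^+ 2 * p - b ^+ 2 * (1 - p) <=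
  d1_energy C v.
Proof.
move=> /andP[p0 p1]; rewrite density_energy (@Rintegral_split _ 0 p 1) ?p0//; last first.
  exact: density_sqr_int.
have := density_tangent 0 p a (lexx 0) p0 p1.
have := density_tangent p 1 b p0 p1 (lexx 1).
have [_ [-> [_ ->]]] := cC.1 _ v01.
lra.
Qed.

(** The test function is 1 on [[p, q]] and 0 elsewhere; the bound is sharp when the section rises
    only on [[p, q]], at unit rate. *)
Lemma energy_ge_incr p q : 0 <= p -> p <= q -> q <= 1 ->
  2 * (C q v - C p v) - (q - p) <= d1_energy C v.
Proof.
move=> p0 pq q1; rewrite density_energy (@Rintegral_split _ 0 p 1); last 2 first.
- by rewrite p0 (le_trans pq).
- exact: density_sqr_int.
rewrite (@Rintegral_split _ p q 1) ?pq//; last exact: density_sqr_int.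
have h a b : 0 <= \int[mu]_(u in `[a, b]) (f u ^+ 2).
  by apply: Rintegral_ge0 => x _; exact: sqr_ge0.
have := density_tangent p q 1 p0 pq q1.
by move: (h 0 p) (h q 1) => {h}; lra.
Qed.

(** [f^2 <= f] because [0 <= f <= 1], and [f] integrates to [v]. *)
Lemma energy_le : d1_energy C v <= v.
Proof.
case: (df) => mf f01 _ If; have := If 0 1 (lexx 0) ler01 (lexx 1).
have [_ [-> [_ ->]]] := cC.1 _ v01; rewrite subr0 => vE.
rewrite density_energy -[leRHS]vE; apply: le_Rintegral => //.
- exact: density_sqr_int.
- exact: density_int.
- by move=> u _; have /andP[? ?] := f01 u; nra.
Qed.

Lemma energy_ge0 : 0 <= d1_energy C v.
Proof. by rewrite density_energy; apply: Rintegral_ge0 => x _; exact: sqr_ge0. Qed.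

End density.

(** By 2-increasingness [C u v' - C u v] is nondecreasing in [u], so the densities are ordered
    almost everywhere. Monotonicity in turn supplies measurability in [v]. *)
Lemma d1_energy_mono C v v' : is_copula C -> 0 <= v -> v <= v' -> v' <= 1 ->
  d1_energy C v <= d1_energy C v'.
Proof.
move=> cC v0 vv' v'1.
have v01 : 0 <= v <= 1 by rewrite v0 (le_trans vv').
have v'01 : 0 <= v' <= 1 by rewrite v'1 (le_trans v0).
have [f df] := density_ex _ _ cC v01; have [g dg] := density_ex _ _ cC v'01.
rewrite (density_energy df) (density_energy dg).
have [mf f01 f' _] := df; have [mg g01 g' _] := dg.
rewrite /Rintegral fine_le//.
- exact/integrable_fin_num/(density_sqr_int df).
- exact/integrable_fin_num/(density_sqr_int dg).
apply: ae_ge0_le_integral => //.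
- by move=> x _; rewrite lee_fin sqr_ge0.
- by apply/measurable_EFinP/measurable_funX; exact: measurable_funS mf.
- by move=> x _; rewrite lee_fin sqr_ge0.
- by apply/measurable_EFinP/measurable_funX; exact: measurable_funS mg.
apply: aeS2 f' g' => x fx gx _; rewrite lee_fin.
have /andP[? ?] := f01 x; have /andP[? ?] := g01 x.
rewrite ler_sqr ?nnegrE//; rewrite -subr_ge0.
apply: (@is_derive_ge0 _ (fun x => usection C v' x - usection C v x) x) => a b ab.
have /andP[a0 a1] := clamp01 a; have /andP[b0 b1] := clamp01 b.
have /andP[cab _] := clamp_slope01 _ _ ab; rewrite subr_ge0 in cab.
have := cC.2 _ _ _ _ a0 cab b1 v0 vv' v'1.
by rewrite /usection; lra.
Qed.

Lemma d1_energy_int C a b : is_copula C -> 0 <= a -> b <= 1 ->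
  mu.-integrable `[a, b] (EFin \o d1_energy C).
Proof.
move=> cC a0 b1; apply: (@bounded_integrable _ _ _ 1).
  apply: nondecreasing_in_measurable => x y ax xy yb.
  by apply: d1_energy_mono => //; [exact: le_trans a0 ax|exact: le_trans yb b1].
move=> x /andP[ax xb]; have x01 : 0 <= x <= 1.
  by rewrite (le_trans a0 ax) (le_trans xb b1).
have [f df] := density_ex _ _ cC x01.
rewrite ger0_norm ?(energy_ge0 df)//.
by apply: le_trans (energy_le cC x01 df) _; case/andP: x01.
Qed.

Lemma diag_int C a b : is_copula C -> 0 <= a -> b <= 1 ->
  mu.-integrable `[a, b] (EFin \o (fun u => C u u)).
Proof.
move=> cC a0 b1; apply: (@bounded_integrable _ _ _ 1).
  apply: nondecreasing_in_measurable => x y ax xy yb.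
  have x01 : 0 <= x <= 1 by rewrite (le_trans a0 ax) (le_trans xy)// (le_trans yb).
  have y0 : 0 <= y by rewrite (le_trans _ xy)//; case/andP: x01.
  have y1 : y <= 1 := le_trans yb b1.
  have y01 : 0 <= y <= 1 by rewrite y0.
  case/andP: (x01) => x0 x1.
  have := copula_slope_u _ _ _ _ cC x0 xy y1 y01.
  have := copula_slope_v _ _ _ _ cC x0 xy y1 x01; lra.
move=> x /andP[ax xb]; have x01 : 0 <= x <= 1.
  by rewrite (le_trans a0 ax) (le_trans xb b1).
have [? _ ? _] := copula_bounds _ _ _ cC x01 x01.
by rewrite ger0_norm//; lra.
Qed.

Lemma xiE C : xi C = 6 * energy C - 2.
Proof.
rewrite /xi energy.unlock; congr (6 * _ - _).
by apply: eq_Rintegral => v _; rewrite d1_energy.unlock.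
Qed.

End copulas.

(** * Integrals of quadratics and of linear combinations *)

Section poly_integral.
Context {R : realType}.
Local Notation mu := (@lebesgue_measure R).

Definition quadf (c0 c1 c2 x : R) := c0 + c1 * x + c2 * x ^+ 2.

Lemma quadf_continuous c0 c1 c2 : continuous (quadf c0 c1 c2).
Proof.
move=> x; apply: cvgD; first apply: cvgD; first exact: cvg_cst.
  by apply: cvgM; [exact: cvg_cst|exact: cvg_id].
by apply: cvgM; [exact: cvg_cst|apply: cvgM; exact: cvg_id].
Qed.

Lemma quadf_int c0 c1 c2 a b : mu.-integrable `[a, b] (EFin \o quadf c0 c1 c2).
Proof. by apply: continuous_integrable => x _; exact: quadf_continuous. Qed.

Lemma Rintegral_quadf c0 c1 c2 a b : a <= b ->
  \int[mu]_(x in `[a, b]) quadf c0 c1 c2 x =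
  c0 * (b - a) + c1 / 2 * (b ^+ 2 - a ^+ 2) + c2 / 3 * (b ^+ 3 - a ^+ 3).
Proof.
move=> ab; pose F (x : R) := c0 * x + c1 / 2 * x ^+ 2 + c2 / 3 * x ^+ 3.
transitivity (F b - F a); last by rewrite /F; field.
apply: FTC2_is_derive => // x _; last exact: quadf_continuous.
by apply: is_derive_eq; rewrite /quadf /GRing.scale /=; field.
Qed.

Lemma Rintegral_lin (D : set R) (k1 k2 : R) (f g : R -> R) : measurable D ->
  mu.-integrable D (EFin \o f) -> mu.-integrable D (EFin \o g) ->
  \int[mu]_(x in D) (k1 * f x + k2 * g x) =
  k1 * \int[mu]_(x in D) f x + k2 * \int[mu]_(x in D) g x.
Proof.
move=> mD fi gi; rewrite RintegralD//; [|exact: RintegrableZ..].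
by rewrite !RintegralZl.
Qed.

End poly_integral.

(** * Ranges of [xi] and [psi], the bound [psi^2 <= xi], and mixtures *)

Section xi_psi.
Context {R : realType}.
Local Notation mu := (@lebesgue_measure R).
Implicit Types (C D : R -> R -> R) (u v p q l t : R).

Lemma xi_le1 C : is_copula C -> xi C <= 1.
Proof.
move=> cC; rewrite xiE energy.unlock.
have : \int[mu]_(v in `[0, 1]) d1_energy C v <= \int[mu]_(v in `[0, 1]) quadf 0 1 0 v.
  apply: le_Rintegral => //; [exact: d1_energy_int|exact: quadf_int|].
  move=> v /=; rewrite in_itv/= => v01; have [f df] := density_ex _ _ cC v01.
  by rewrite /quadf mul0r addr0 add0r mul1r; exact: (energy_le cC v01 df).
by rewrite Rintegral_quadf//; lra.
Qed.

Lemma psi_le1 C : is_copula C -> psi C <= 1.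
Proof.
move=> cC; rewrite /psi.
have : \int[mu]_(u in `[0, 1]) C u u <= \int[mu]_(v in `[0, 1]) quadf 0 1 0 v.
  apply: le_Rintegral => //; [exact: diag_int|exact: quadf_int|].
  move=> v /=; rewrite in_itv/= => v01.
  by have [_ _ ? _] := copula_bounds _ _ _ cC v01 v01; rewrite /quadf; lra.
by rewrite Rintegral_quadf//; lra.
Qed.

Lemma psi_ge C : is_copula C -> - (1 / 2) <= psi C.
Proof.
move=> cC; rewrite /psi.
(* The lower bound [max (0, 2 v - 1)] of the diagonal changes branch at 1/2. *)
rewrite (@Rintegral_split _ 0 (1/2) 1); last 2 first.
- by apply/andP; split; lra.
- exact: diag_int.
have h1 : \int[mu]_(u in `[(1 / 2), 1]) quadf (-1) 2 0 u <=
    \int[mu]_(u in `[(1 / 2), 1]) C u u.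
  apply: le_Rintegral => //; [exact: quadf_int|apply: diag_int => //; lra|].
  move=> v /=; rewrite in_itv/= => /andP[v0 v1].
  have v01 : 0 <= v <= 1 by rewrite v1; lra.
  by have [_ ? _ _] := copula_bounds _ _ _ cC v01 v01; rewrite /quadf; lra.
have h2 : 0 <= \int[mu]_(u in `[0, (1 / 2)]) C u u.
  apply: Rintegral_ge0 => v /=; rewrite in_itv/= => /andP[v0 v1].
  have v01 : 0 <= v <= 1 by rewrite v0; lra.
  by have [? _ _ _] := copula_bounds _ _ _ cC v01 v01.
by move: h1 h2; rewrite Rintegral_quadf//; lra.
Qed.

(* The test function of [energy_ge2] is the density of the affine combination
   [t M + (1 - t) Pi] of the comonotone and the independence copula. *)
Lemma psi_tangent C t : is_copula C -> 2 * t * psi C - t ^+ 2 <= xi C.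
Proof.
move=> cC; rewrite xiE energy.unlock /psi.
have : \int[mu]_(v in `[0, 1]) (1 * quadf 0 (- t ^+ 2) (1 - 2 * t + t ^+ 2) v +
      2 * t * C v v) <= \int[mu]_(v in `[0, 1]) d1_energy C v.
  apply: le_Rintegral => //; last first.
  - move=> v /=; rewrite in_itv/= => v01; have [f df] := density_ex _ _ cC v01.
    have := energy_ge2 cC v01 df v (v + (1 - v) * t) (v - v * t) v01.
    by apply: le_trans; rewrite /quadf le_eqVlt; apply/orP; left; apply/eqP; ring.
  - exact: d1_energy_int.
  - by apply: RintegrableD => //; apply: RintegrableZ => //; [exact: quadf_int|exact: diag_int].
rewrite Rintegral_lin//; [|exact: quadf_int|exact: diag_int].
by rewrite Rintegral_quadf//; lra.
Qed.

(** [t = psi C] maximises the left side of [psi_tangent]. *)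
Lemma psi_sqr_le_xi C : is_copula C -> psi C ^+ 2 <= xi C.
Proof. by move=> cC; have := psi_tangent C (psi C) cC; lra. Qed.

Lemma psi_le_sqrt_xi C : is_copula C -> psi C <= Num.sqrt (xi C).
Proof.
move=> cC; apply: le_trans (ler_norm _) _.
by rewrite -sqrtr_sqr ler_wsqrtr// psi_sqr_le_xi.
Qed.

Lemma xi_ge0 C : is_copula C -> 0 <= xi C.
Proof. by move=> cC; apply: le_trans (psi_sqr_le_xi _ cC); exact: sqr_ge0. Qed.

Definition mix l C D u v := l * C u v + (1 - l) * D u v.

Lemma mix_copula l C D : 0 <= l <= 1 -> is_copula C -> is_copula D ->
  is_copula (mix l C D).
Proof.
move=> l01 [Cb C2] [Db D2]; split => [u u01|].
  have [C1 [? [? ?]]] := Cb _ u01; have [? [? [? ?]]] := Db _ u01.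
  by rewrite /mix; repeat split; nra.
move=> u1 u2 v1 v2 h1 h2 h3 h4 h5 h6.
have c := C2 _ _ _ _ h1 h2 h3 h4 h5 h6; have d := D2 _ _ _ _ h1 h2 h3 h4 h5 h6.
by rewrite /mix; nra.
Qed.

Lemma psi_mix l C D : is_copula C -> is_copula D ->
  psi (mix l C D) = l * psi C + (1 - l) * psi D.
Proof.
move=> cC cD; rewrite /psi /mix Rintegral_lin//; [ring|exact: diag_int..].
Qed.

(** [B] is the inner product of the two densities, and the last bound integrates
    [2 f g <= f^2 + g^2]. *)
Lemma d1_energy_mixE C D v : is_copula C -> is_copula D -> 0 <= v <= 1 ->
  exists2 B : R, forall l, d1_energy (mix l C D) v =
    l ^+ 2 * d1_energy C v + (1 - l) ^+ 2 * d1_energy D v + 2 * l * (1 - l) * B &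
    2 * B <= d1_energy C v + d1_energy D v.
Proof.
move=> cC cD v01.
have [f df] := density_ex _ _ cC v01; have [g dg] := density_ex _ _ cD v01.
have [mf f01 f' _] := df; have [mg g01 g' _] := dg.
have mfg : measurable_fun setT (fun u => f u * g u) by exact: measurable_funM.
have fgi : mu.-integrable `[0, 1] (EFin \o (fun u => f u * g u)).
  apply: (@bounded_integrable _ _ _ 1); first exact: measurable_funS mfg.
  move=> x _; have /andP[? ?] := f01 x; have /andP[? ?] := g01 x.
  by rewrite ger0_norm ?mulr_ge0// mulr_ile1.
have fi : mu.-integrable `[0, 1] (EFin \o (fun u => f u ^+ 2)) := density_sqr_int df 0 1.
have gi : mu.-integrable `[0, 1] (EFin \o (fun u => g u ^+ 2)) := density_sqr_int dg 0 1.
have lin (a b c : R) : \int[mu]_(u in `[0, 1])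
    (1 * (a * f u ^+ 2 + b * g u ^+ 2) + c * (f u * g u)) =
    a * d1_energy C v + b * d1_energy D v + c * \int[mu]_(u in `[0, 1]) (f u * g u).
  rewrite Rintegral_lin//; last by apply: RintegrableD => //; exact: RintegrableZ.
  by rewrite Rintegral_lin// (density_energy df) (density_energy dg) mul1r.
exists (\int[mu]_(u in `[0, 1]) (f u * g u)) => [l|].
  rewrite (@d1_energyE _ _ _ (fun u => l * f u + (1 - l) * g u)).
  - rewrite -lin; apply: eq_Rintegral => u _; ring.
  - by apply: measurable_funD; exact: measurable_funM.
  - apply: aeS2 f' g' => u fu gu.
    have : is_derive u 1 (l *: usection C v + (1 - l) *: usection D v)
      (l *: f u + (1 - l) *: g u) by apply: is_deriveD.
    exact.
have : 0 <= \int[mu]_(u in `[0, 1])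
    (1 * (1 * f u ^+ 2 + 1 * g u ^+ 2) + (- 2) * (f u * g u)).
  by apply: Rintegral_ge0 => u _; have := sqr_ge0 (f u - g u); lra.
by rewrite (lin 1 1 (-2)); lra.
Qed.

(** To avoid integrating the cross term over [v], it is eliminated in favour of the energy of the
    midpoint [H]: a quadratic in [l] is determined by its values at 0, 1/2 and 1. *)
Lemma xi_mix C D : is_copula C -> is_copula D ->
  exists2 B : R, forall l, 0 <= l <= 1 -> xi (mix l C D) =
    l ^+ 2 * xi C + (1 - l) ^+ 2 * xi D + 2 * l * (1 - l) * B &
    2 * B <= xi C + xi D.
Proof.
move=> cC cD; have h01 : 0 <= (1 / 2 : R) <= 1 by apply/andP; split; lra.
have cH := mix_copula _ _ _ h01 cC cD.
pose H := mix (1 / 2) C D.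
have iC := d1_energy_int C 0 1 cC (lexx 0) (lexx 1).
have iD := d1_energy_int D 0 1 cD (lexx 0) (lexx 1).
have iH := d1_energy_int H 0 1 cH (lexx 0) (lexx 1).
have E l : energy (mix l C D) = (l ^+ 2 - l * (1 - l)) * energy C +
    ((1 - l) ^+ 2 - l * (1 - l)) * energy D + 4 * l * (1 - l) * energy H.
  transitivity (\int[mu]_(v in `[0, 1]) (1 *
      ((l ^+ 2 - l * (1 - l)) * d1_energy C v +
      ((1 - l) ^+ 2 - l * (1 - l)) * d1_energy D v) +
      4 * l * (1 - l) * d1_energy H v)).
    rewrite energy.unlock; apply: eq_Rintegral => v.
    rewrite inE/= in_itv/= => v01.
    have [B BE _] := d1_energy_mixE C D v cC cD v01.
    by rewrite /H !BE; field.
  rewrite Rintegral_lin//; last by apply: RintegrableD => //; exact: RintegrableZ.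
  by rewrite Rintegral_lin// energy.unlock mul1r.
exists (2 * xi H - (xi C + xi D) / 2) => [l l01|]; first by rewrite !xiE E; field.
suff : energy H <= 1 / 2 * energy C + 1 / 2 * energy D by rewrite !xiE; lra.
rewrite energy.unlock -Rintegral_lin//.
apply: le_Rintegral => //; first by apply: RintegrableD => //; exact: RintegrableZ.
move=> v /=; rewrite in_itv/= => v01.
have [B BE BL] := d1_energy_mixE C D v cC cD v01.
by rewrite /H BE; lra.
Qed.

End xi_psi.

(** * Shuffles, horizontal segments in the region, and convexity *)

Section region.
Context {R : realType}.
Local Notation mu := (@lebesgue_measure R).
Implicit Types (C D : R -> R -> R) (u v p q l t : R).

Lemma addmax_2increasing t (a1 a2 b1 b2 : R) : a1 <= a2 -> b1 <= b2 ->
  0 <= Num.max 0 (a2 + b2 - t) - Num.max 0 (a2 + b1 - t) -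
       Num.max 0 (a1 + b2 - t) + Num.max 0 (a1 + b1 - t).
Proof.
move=> a12 b12.
case: (leP 0 (a2 + b2 - t)) => ?; case: (leP 0 (a2 + b1 - t)) => ?;
case: (leP 0 (a1 + b2 - t)) => ?; case: (leP 0 (a1 + b1 - t)) => ?; lra.
Qed.

Lemma min_2increasing (a1 a2 b1 b2 : R) : a1 <= a2 -> b1 <= b2 ->
  0 <= Num.min a2 b2 - Num.min a2 b1 - Num.min a1 b2 + Num.min a1 b1.
Proof.
move=> a12 b12.
case: (leP a2 b2) => ?; case: (leP a2 b1) => ?;
case: (leP a1 b2) => ?; case: (leP a1 b1) => ?; lra.
Qed.

(* The ordinal sum of the countermonotone copula on [0, t] and the comonotone
   copula on [t, 1]. *)
Definition shuffle t u v :=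
  Num.max 0 (Num.min u t + Num.min v t - t) +
  Num.min (Num.max 0 (u - t)) (Num.max 0 (v - t)).

Lemma shuffle_ll t u v : u <= t -> v <= t -> shuffle t u v = Num.max 0 (u + v - t).
Proof.
move=> ut vt; rewrite /shuffle (min_l ut) (min_l vt).
have -> : Num.max 0 (u - t) = 0 by rewrite max_l// subr_le0.
by rewrite min_l ?addr0// le_max lexx.
Qed.

Lemma shuffle_gg t u v : 0 <= t -> t <= u -> t <= v -> shuffle t u v = Num.min u v.
Proof.
move=> t0 ut vt; rewrite /shuffle !(@min_r _ _ _ t)// !max_r ?subr_ge0//; last lra.
by case: (leP u v) => uv; [rewrite min_l|rewrite min_r]; lra.
Qed.

Lemma shuffle_gl t u v : 0 <= v -> t <= u -> v <= t -> shuffle t u v = v.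
Proof.
move=> v0 ut vt; rewrite /shuffle (@min_r _ _ u t)// (@min_l _ _ v t)//.
rewrite (@max_r _ _ 0 (u - t)) ?subr_ge0// (@max_l _ _ 0 (v - t)) ?subr_le0//.
by rewrite min_r ?subr_ge0// addr0 max_r; lra.
Qed.

Lemma shuffleC t u v : shuffle t u v = shuffle t v u.
Proof. rewrite /shuffle (addrC (Num.min u t)).
by rewrite (minC (Num.max 0 (u - t))). Qed.

Lemma shuffle_copula t : 0 <= t <= 1 -> is_copula (shuffle t).
Proof.
move=> /andP[t0 t1]; split => [u /andP[u0 u1]|u1 u2 v1 v2 h1 h2 h3 h4 h5 h6].
  have a0 : shuffle t u 0 = 0.
    have [ut|/ltW tu] := leP u t; last by rewrite shuffle_gl.
    by rewrite shuffle_ll// max_l//; lra.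
  have a1 : shuffle t u 1 = u.
    have [ut|/ltW tu] := leP u t; first by rewrite shuffleC shuffle_gl.
    by rewrite shuffle_gg// min_l.
  by rewrite ![shuffle t _ u]shuffleC.
rewrite /shuffle.
have m a b : a <= b -> Num.min a t <= Num.min b t.
  by move=> ab; rewrite le_min !ge_min ab lexx orbT.
have M a b : a <= b -> Num.max 0 (a - t) <= Num.max 0 (b - t).
  by move=> ab; rewrite ge_max !le_max lexx/= lerD2r ab orbT.
have := addmax_2increasing t _ _ _ _ (m _ _ h2) (m _ _ h5).
have := min_2increasing _ _ _ _ (M _ _ h2) (M _ _ h5).
lra.
Qed.

(** Every section has slope 0 or 1, so its energy attains the upper bound [v] of [energy_le]. *)
Lemma shuffle_xi t : 0 <= t <= 1 -> xi (shuffle t) = 1.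
Proof.
move=> t01; have cD := shuffle_copula t t01; case/andP: t01 => t0 t1.
rewrite xiE; suff -> : energy (shuffle t) = \int[mu]_(v in `[0, 1]) quadf 0 1 0 v.
  by rewrite Rintegral_quadf//; field.
rewrite energy.unlock; apply: eq_Rintegral => v; rewrite inE/= in_itv/= => v01.
have [f df] := density_ex _ _ cD v01.
rewrite /quadf mul0r addr0 add0r mul1r; apply/le_anti.
rewrite (energy_le cD v01 df) /=; case/andP: v01 => v0 v1.
have [vt|/ltW tv] := leP v t.
  (* For [v <= t] the section rises exactly on [[t - v, t]]; for [t <= v], an increment of [v] over
     [[0, v]] is used. *)
  have := energy_ge_incr df (t - v) t; rewrite shuffle_gl// shuffle_ll//; last lra.
  by rewrite max_l; last lra; move=> h; apply: le_trans (h _ _ _); lra.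
have := energy_ge_incr df 0 v; rewrite shuffle_gg// minxx shuffleC shuffle_gl//.
by move=> h; apply: le_trans (h _ _ _); lra.
Qed.

Lemma shuffle_psi t : 0 <= t <= 1 -> psi (shuffle t) = 1 - 3 / 2 * t ^+ 2.
Proof.
move=> t01; have cD := shuffle_copula t t01; case/andP: t01 => t0 t1.
(* The diagonal is 0 up to [t / 2], then [2 u - t] up to [t], then [u]. *)
rewrite /psi (@Rintegral_split _ 0 (t / 2) 1); last 2 first.
- by apply/andP; split; lra.
- exact: diag_int.
rewrite (@Rintegral_split _ (t / 2) t 1); last 2 first.
- by apply/andP; split; lra.
- by apply: diag_int => //; lra.
have -> : \int[mu]_(u in `[0, t / 2]) shuffle t u u =
    \int[mu]_(u in `[0, t / 2]) quadf 0 0 0 u.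
  apply: eq_Rintegral => u; rewrite inE/= in_itv/= => /andP[u0 u1].
  by rewrite shuffle_ll ?max_l /quadf; lra.
have -> : \int[mu]_(u in `[t / 2, t]) shuffle t u u =
    \int[mu]_(u in `[t / 2, t]) quadf (- t) 2 0 u.
  apply: eq_Rintegral => u; rewrite inE/= in_itv/= => /andP[u0 u1].
  by rewrite shuffle_ll ?max_r /quadf; lra.
have -> : \int[mu]_(u in `[t, 1]) shuffle t u u =
    \int[mu]_(u in `[t, 1]) quadf 0 1 0 u.
  apply: eq_Rintegral => u; rewrite inE/= in_itv/= => /andP[u0 u1].
  by rewrite shuffle_gg// minxx /quadf; lra.
by rewrite !Rintegral_quadf; [field|lra..].
Qed.

Lemma shuffle_ex y : - (1 / 2) <= y <= 1 ->
  exists D, [/\ is_copula D, xi D = 1 & psi D = y].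
Proof.
(* Solves [1 - 3 / 2 * t^2 = y]; the range of [y] corresponds to [t] in [0, 1]. *)
move=> /andP[y0 y1]; pose t := Num.sqrt (2 / 3 * (1 - y)).
have tE : t ^+ 2 = 2 / 3 * (1 - y) by rewrite sqr_sqrtr; lra.
have t01 : 0 <= t <= 1 by rewrite sqrtr_ge0 -sqrtr1 ler_wsqrtr//; lra.
exists (shuffle t); split; [exact: shuffle_copula|exact: shuffle_xi|].
by rewrite shuffle_psi// tE; field.
Qed.

(** Mixing [C] with a shuffle of the same [psi] leaves [psi] fixed, while [xi] is a quadratic in the
    weight running from 1 at [l = 0] to [xi C] at [l = 1]; the intermediate value theorem yields
    [x]. *)
Lemma region_ray C x : is_copula C -> xi C <= x <= 1 -> xi_psi_region (x, psi C).
Proof.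
move=> cC /andP[xC x1].
have [|D [cD xD pD]] := shuffle_ex (psi C); first by rewrite psi_ge ?psi_le1.
have [B BE _] := xi_mix C D cC cD; rewrite xD in BE.
pose P : {poly R} := (xi C + 1 - 2 * B)%:P * 'X^2 + (2 * B - 2)%:P * 'X + (1 - x)%:P.
have PE l : P.[l] = l ^+ 2 * xi C + (1 - l) ^+ 2 * 1 + 2 * l * (1 - l) * B - x.
  rewrite /P !hornerD !hornerCM hornerXn hornerX hornerC; ring.
have [||l l01 /eqP] := @poly_ivt _ (- P) 0 1; first exact: ler01.
  rewrite !hornerN !PE; move: (xi C) xC => a ax.
  by clear -ax x1; apply/andP; split; lra.
rewrite hornerN PE => /eqP; rewrite oppr_eq0 subr_eq0 => /eqP Pl.
exists (mix l C D); split; first exact: mix_copula.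
rewrite BE//; congr pair; first by rewrite Pl.
by rewrite psi_mix// pD; ring.
Qed.

(** The mixture has the required [psi] and a [xi] no larger than the convex combination, so
    [region_ray] reaches the target point. *)
Lemma region_convex :
  convex_set (@xi_psi_region R : set (convex_lmodType (R * R)%type)).
Proof.
move=> _ _ l /set_mem[C [cC ->]] /set_mem[D [cD ->]]; apply/mem_set.
have l01 : 0 <= l%:num <= 1 by apply/andP; split.
have cM := mix_copula _ _ _ l01 cC cD.
have [B BE BL] := xi_mix C D cC cD.
suff -> : (conv l ((xi C, psi C) : convex_lmodType (R * R)%type) (xi D, psi D)) =
  (l%:num * xi C + (1 - l%:num) * xi D, psi (mix l%:num C D)).
  apply: region_ray => //; rewrite BE//; move: (xi_le1 C cC) (xi_le1 D cD).
  move: l01 BL => /andP[]; move: (l%:num) (xi C) (xi D) => a b c a0 a1 BL b1 c1.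
  (* This is exactly the convex combination minus [xi] of the mixture; [h1] and [h2] sum to 1 minus
     the convex combination. *)
  have h : 0 <= a * (1 - a) * (b + c - 2 * B) by rewrite !mulr_ge0//; lra.
  have h1 : 0 <= a * (1 - b) by rewrite mulr_ge0//; lra.
  have h2 : 0 <= (1 - a) * (1 - c) by rewrite mulr_ge0//; lra.
  by apply/andP; split; lra.
by rewrite psi_mix.
Qed.

End region.

(** * The lower bound by [Xi] and the root of the cubic *)

Section lower_bound.
Context {R : realType}.
Local Notation mu := (@lebesgue_measure R).
Implicit Types (C : R -> R -> R) (u v x y m w k : R).

Lemma gt0_inv_continuous (a : R) : 0 < a -> {for a, continuous (fun x : R => x^-1)}.
Proof. by move=> a0; apply: inv_continuous; rewrite gt_eqF. Qed.

Lemma Rintegral_inv (a b : R) : 0 < a -> a <= b ->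
  \int[mu]_(x in `[a, b]) x^-1 = ln b - ln a.
Proof.
move=> a0 ab; apply: FTC2_is_derive => // x /andP[ax _].
  by apply: is_derive1_ln; exact: lt_le_trans ax.
by apply: gt0_inv_continuous; exact: lt_le_trans ax.
Qed.

Lemma inv_int (a b : R) : 0 < a ->
  mu.-integrable `[a, b] (EFin \o (fun x : R => x^-1)).
Proof.
move=> a0; apply: continuous_integrable => x /andP[ax _].
by apply: gt0_inv_continuous; exact: lt_le_trans ax.
Qed.

Lemma onem_inv_continuous (b : R) : b < 1 ->
  {for b, continuous (fun x : R => (1 - x)^-1)}.
Proof.
move=> b1; apply: cvgV; first by rewrite subr_eq0 gt_eqF.
by apply: cvgB; [exact: cvg_cst|exact: cvg_id].
Qed.

Lemma Rintegral_onem_inv (a b : R) : a <= b -> b < 1 ->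
  \int[mu]_(x in `[a, b]) (1 - x)^-1 = ln (1 - a) - ln (1 - b).
Proof.
move=> ab b1; rewrite (_ : ln (1 - a) - ln (1 - b) = - ln (1 - b) - - ln (1 - a)); last ring.
apply: (@FTC2_is_derive _ _ _ (fun x => - ln (1 - x))) => // x /andP[_ xb].
  have x1 : 0 < 1 - x by lra.
  have := is_derive1_ln x1; move=> dln.
  have : is_derive x 1 (- ((@ln R) \o (fun x => 1 - x))) (- ((1 - x)^-1 * (0 - 1))).
    by apply: is_deriveN; apply: is_derive1_comp.
  by move=> /is_derive_eq; apply; ring.
by apply: onem_inv_continuous; exact: le_lt_trans b1.
Qed.

Lemma onem_inv_int (a b : R) : b < 1 ->
  mu.-integrable `[a, b] (EFin \o (fun x : R => (1 - x)^-1)).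
Proof.
move=> b1; apply: continuous_integrable => x /andP[_ xb].
by apply: onem_inv_continuous; exact: le_lt_trans b1.
Qed.

Lemma energy_diag_int C k (a b : R) : is_copula C -> 0 <= a -> b <= 1 ->
  mu.-integrable `[a, b] (EFin \o (fun v => 1 * d1_energy C v + k * C v v)).
Proof.
move=> cC a0 b1; apply: RintegrableD => //; apply: RintegrableZ => //.
  exact: d1_energy_int.
exact: diag_int.
Qed.

(* In the next three lemmas [k = mu / 2] and the slopes passed to [energy_ge2]
   are the minimiser of the Lagrangian [int f^2 + mu * int_0^v f] over
   [0 <= f <= 1] with mean [v]: first with [f = 0] active on [[0, v]], then
   unconstrained, then with [f = 1] active on [[v, 1]]. *)
Lemma lagrangian_low C k v : is_copula C -> 0 <= k -> 0 <= v -> v < 1 ->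
  v <= k * (1 - v) ->
  1 * quadf (-1) (-1) 0 v + 1 * (1 - v)^-1 <= 1 * d1_energy C v + 2 * k * C v v.
Proof.
move=> cC k0 v0 v1 kv; have v01 : 0 <= v <= 1 by rewrite v0 ltW.
have [f df] := density_ex _ _ cC v01; have [c0 _ _ _] := copula_bounds _ _ _ cC v01 v01.
(* With slope 0 on [[0, v]], the mean [v] forces slope [v / (1 - v)] on [[v, 1]]. *)
have [b bE] : {b | b = v / (1 - v)} by exists (v / (1 - v)).
have bv : b * (1 - v) = v by rewrite bE mulfVK// gt_eqF//; lra.
have -> : (1 - v)^-1 = b + 1 by rewrite bE; field; rewrite gt_eqF//; lra.
have := energy_ge2 cC v01 df v 0 b v01; rewrite /quadf => E.
have bk : b <= k by rewrite bE ler_pdivrMr//; lra.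
(* [energy_ge2] leaves twice this term over; the condition on [v] is exactly [b <= k]. *)
have : 0 <= (k - b) * C v v by rewrite mulr_ge0//; lra.
have : b ^+ 2 * (1 - v) = b * v by rewrite expr2 -mulrA bv.
have : b * v = b - v by lra.
by move: (d1_energy C v) (C v v) E => G c; lra.
Qed.

Lemma lagrangian_mid C k v : is_copula C -> 0 <= v <= 1 ->
  quadf 0 (- k ^+ 2) (1 + 2 * k + k ^+ 2) v <= 1 * d1_energy C v + 2 * k * C v v.
Proof.
move=> cC v01; have [f df] := density_ex _ _ cC v01.
have := energy_ge2 cC v01 df v (v - k * (1 - v)) (v + k * v) v01.
by rewrite /quadf; move: (d1_energy C v) (C v v) => G c; lra.
Qed.

Lemma lagrangian_high C k v : is_copula C -> 0 <= k -> 0 < v -> v <= 1 ->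
  1 - v <= k * v ->
  1 * quadf (- 3 - 2 * k) (3 + 4 * k) 0 v + 1 * v^-1 <=
  1 * d1_energy C v + 2 * k * C v v.
Proof.
move=> cC k0 v0 v1 kv; have v01 : 0 <= v <= 1 by rewrite v1 ltW.
have [f df] := density_ex _ _ cC v01; have [_ c0 _ _] := copula_bounds _ _ _ cC v01 v01.
have := energy_ge2 cC v01 df v (2 - v^-1) 1 v01.
have vV : v^-1 * v = 1 by rewrite mulVf// gt_eqF.
have kV : v^-1 - 1 <= k.
  by rewrite -(ler_pM2r v0) mulrBl vV mul1r.
move: (v^-1) vV kV => i vV kV; rewrite /quadf => E.
(* Here the diagonal is bounded by [2 v - 1 <= C v v], with a coefficient made nonnegative by the
   condition on [v]. *)
have : 0 <= (k + 1 - i) * (C v v - (2 * v - 1)) by rewrite mulr_ge0//; lra.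
have : i ^+ 2 * v = i by rewrite expr2 -mulrA vV mulr1.
by move: (d1_energy C v) (C v v) E => G c; lra.
Qed.

(** Integrating the three Lagrangian bounds over [[0, 1 - w]], [[1 - w, w]] and [[w, 1]] bounds a
    combination of [xi C] and [psi C]; the cubic then expresses [psi C] through [w]. *)
Lemma xi_lower_bound C m : is_copula C -> 0 <= m <= 2 -> mu_cubic (psi C) m = 0 ->
  Xi m <= xi C.
Proof.
move=> cC /andP[m0 m2] mE.
(* [w = 1 / (1 + k)] is the [v1] of [Xi]: the two constrained regimes are [v <= 1 - w] and [w <= v].
   Since [m <= 2], [1 - w <= w]. *)
pose w := 2 / (2 + m); pose k := m / 2.
have w1 : w <= 1 by rewrite ler_pdivrMr; lra.
have w2 : 1 / 2 <= w by rewrite ler_pdivlMr; lra.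
have wk : w * (1 + k) = 1 by rewrite /w /k; field; rewrite gt_eqF; lra.
have w0 : 0 < w by lra.
have wN0 : w != 0 by rewrite gt_eqF.
have kE : k = w^-1 - 1 by rewrite /w /k; field; rewrite gt_eqF; lra.
have mw : m = 2 / w - 2 by rewrite /w; field; rewrite gt_eqF; lra.
have k0 : 0 <= k by rewrite /k; lra.
have yE : psi C = - 2 * w ^+ 2 + 6 * w - 5 + w^-1.
  (* The cubic is this relation with denominators cleared after [m = 2 / w - 2]; the factor
     [- (w^2 / 8)] reverses the clearing. *)
  apply/eqP; rewrite -subr_eq0; apply/eqP.
  transitivity (- (w ^+ 2 / 8) * mu_cubic (psi C) m); last by rewrite mE mulr0.
  by rewrite /mu_cubic mw; move: (psi C) => y; field.
have h1 : \int[mu]_(v in `[0, 1 - w]) (1 * quadf (-1) (-1) 0 v + 1 * (1 - v)^-1) <=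
    \int[mu]_(v in `[0, 1 - w]) (1 * d1_energy C v + 2 * k * C v v).
  apply: le_Rintegral => //.
  - apply: RintegrableD => //; apply: RintegrableZ => //; first exact: quadf_int.
    by apply: onem_inv_int; lra.
  - by apply: energy_diag_int => //; lra.
  - move=> v /=; rewrite in_itv/= => /andP[v0 vw]; apply: lagrangian_low => //; first lra.
    by rewrite kE; nra.
have h2 : \int[mu]_(v in `[1 - w, w]) quadf 0 (- k ^+ 2) (1 + 2 * k + k ^+ 2) v <=
    \int[mu]_(v in `[1 - w, w]) (1 * d1_energy C v + 2 * k * C v v).
  apply: le_Rintegral => //; [exact: quadf_int|by apply: energy_diag_int => //; lra|].
  move=> v /=; rewrite in_itv/= => /andP[v0 vw]; apply: lagrangian_mid => //.
  by apply/andP; split; lra.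
have h3 : \int[mu]_(v in `[w, 1])
      (1 * quadf (- 3 - 2 * k) (3 + 4 * k) 0 v + 1 * v^-1) <=
    \int[mu]_(v in `[w, 1]) (1 * d1_energy C v + 2 * k * C v v).
  apply: le_Rintegral => //.
  - apply: RintegrableD => //; apply: RintegrableZ => //; first exact: quadf_int.
    exact: inv_int.
  - by apply: energy_diag_int => //; lra.
  - move=> v /=; rewrite in_itv/= => /andP[v0 vw]; apply: lagrangian_high => //; first lra.
    by rewrite kE; nra.
have hE : \int[mu]_(v in `[0, 1]) (1 * d1_energy C v + 2 * k * C v v) =
    (xi C + 2) / 6 + 2 * k * ((psi C + 2) / 6).
  rewrite Rintegral_lin//; [|exact: d1_energy_int|exact: diag_int].
  rewrite xiE energy.unlock /psi.
  by move: (\int[mu]_(v in _) _) (\int[mu]_(v in _) _) => a b; field.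
move: hE; rewrite (@Rintegral_split _ 0 (1 - w) 1); last 2 first.
- by apply/andP; split; lra.
- exact: energy_diag_int.
rewrite (@Rintegral_split _ (1 - w) w 1); last 2 first.
- by apply/andP; split; lra.
- by apply: energy_diag_int => //; lra.
move: h1; rewrite [leLHS]Rintegral_lin//; last 2 first.
- exact: quadf_int.
- by apply: onem_inv_int; lra.
rewrite Rintegral_quadf; last lra.
rewrite Rintegral_onem_inv; [|lra..].
move: h2; rewrite Rintegral_quadf; last lra.
move: h3; rewrite [leLHS]Rintegral_lin//; [|exact: quadf_int|exact: inv_int].
rewrite Rintegral_quadf; last lra.
rewrite Rintegral_inv; [|lra..].
rewrite !subr0 subKr ln1.
set J3 := Rintegral _ _ _; set J2 := Rintegral _ _ _; set J1 := Rintegral _ _ _.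
rewrite /Xi -/w yE kE; move: (xi C) (ln w) J1 J2 J3 => x L J1 J2 J3 h3 h2 h1 hE.
(* The right side is six times the sum of the three computed integrals, minus 2, minus
   [2 k (psi C + 2)]: the identity [hE] solved for [xi C]. *)
have -> : - 4 * w ^+ 2 + 20 * w - 17 + 2 / w - 1 / w ^+ 2 - 12 * L =
  6 * ((1 * (-1 * (1 - w) + -1 / 2 * ((1 - w) ^+ 2 - 0 ^+ 2) +
    0 / 3 * ((1 - w) ^+ 3 - 0 ^+ 3)) + 1 * (0 - L)) +
  ((0 * (w - (1 - w)) + - (w^-1 - 1) ^+ 2 / 2 * (w ^+ 2 - (1 - w) ^+ 2) +
    (1 + 2 * (w^-1 - 1) + (w^-1 - 1) ^+ 2) / 3 * (w ^+ 3 - (1 - w) ^+ 3)) +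
  (1 * ((- 3 - 2 * (w^-1 - 1)) * (1 - w) +
    (3 + 4 * (w^-1 - 1)) / 2 * (1 ^+ 2 - w ^+ 2) + 0 / 3 * (1 ^+ 3 - w ^+ 3)) +
    1 * (0 - L)))) - 2 -
  2 * (w^-1 - 1) * (- 2 * w ^+ 2 + 6 * w - 5 + w^-1 + 2).
  by field.
by clear -h1 h2 h3 hE; lra.
Qed.

Lemma mu_cubic_root y : - (1 / 2) <= y <= 0 ->
  exists2 m : R, 0 <= m <= 2 /\ mu_cubic y m = 0 &
    forall m', 0 <= m' <= 2 -> mu_cubic y m' = 0 -> m' = m.
Proof.
move=> /andP[y0 y1].
pose P : {poly R} := 'X^3 - (4 + 2 * y)%:P * 'X^2 - (4 + 8 * y)%:P * 'X - (8 * y)%:P.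
have PE m : P.[m] = mu_cubic y m.
  by rewrite /P !hornerD !hornerN !hornerCM !hornerXn hornerX hornerC.
(* The cubic equals [- 8 y >= 0] at 0 and [- 16 (1 + 2 y) <= 0] at 2, hence the sign change. *)
have [||m m02 mE] := @poly_ivt _ (- P) 0 2; first lra.
  by rewrite !hornerN !PE /mu_cubic; apply/andP; split; lra.
have {}mE : mu_cubic y m = 0.
  by move: mE; rewrite rootE hornerN PE oppr_eq0 => /eqP.
exists m => // m' m'02 m'E.
have : (m' - m) * (m' ^+ 2 + m' * m + m ^+ 2 - (4 + 2 * y) * (m' + m) - (4 + 8 * y)) = 0.
  transitivity (mu_cubic y m' - mu_cubic y m); last by rewrite mE m'E subrr.
  by rewrite /mu_cubic; ring.
move/eqP; rewrite mulf_eq0 subr_eq0 => /orP[/eqP//|/eqP E].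
case/andP: m02 => m0 m2; case/andP: m'02 => m'0 m'2.
(* The cofactor is minus the sum of [a1], [a2], half of [a3 + a4], [a5] and [4 (1 + 2 y)], so it
   vanishes only if all of these do. This can occur at [y = - 1/2], where 2 is a double root; then
   [b3] and [b4] still force [m' = m]. *)
have a1 : 0 <= m * (2 - m) by rewrite mulr_ge0//; lra.
have a2 : 0 <= m' * (2 - m') by rewrite mulr_ge0//; lra.
have a3 : 0 <= m * (2 - m') by rewrite mulr_ge0//; lra.
have a4 : 0 <= m' * (2 - m) by rewrite mulr_ge0//; lra.
have a5 : 0 <= (1 + 2 * y) * (m + m') by rewrite mulr_ge0//; lra.
have b1 : m * (2 - m) = 0 by lra.
have b2 : m' * (2 - m') = 0 by lra.
have b3 : m * (2 - m') = 0 by lra.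
have b4 : m' * (2 - m) = 0 by lra.
by lra.
Qed.

End lower_bound.

(** * Difference quotients and their energy *)

Section quotient.
Context {R : realType}.
Local Notation mu := (@lebesgue_measure R).
Implicit Types (F f : R -> R) (h u : R).

Lemma Rintegral_bounded_cvg (a b : R) (f_ : nat -> R -> R) f :
  (forall n, measurable_fun `[a, b] (f_ n)) -> measurable_fun `[a, b] f ->
  (forall n x, a <= x <= b -> `|f_ n x| <= 1) ->
  {ae mu, forall x, a <= x <= b -> f_ n x @[n --> \oo] --> f x} ->
  \int[mu]_(x in `[a, b]) f_ n x @[n --> \oo] --> \int[mu]_(x in `[a, b]) f x.
Proof.
move=> mf_ mf f1 ff.
have [|||||i _ h] := @dominated_convergence _ _ R mu `[a, b] (measurable_itv _)
  (fun n => EFin \o f_ n) (EFin \o f) (EFin \o cst 1).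
- by move=> n; apply/measurable_EFinP; exact: mf_.
- by apply/measurable_EFinP; exact: mf.
- apply: aeS ff => x fx; rewrite /= in_itv/= => /fx.
  by move=> fx'; apply/cvg_EFin => //; exact: nearW.
- by apply: continuous_integrable => x _; exact: cvg_cst.
- by apply: aeW => x n; rewrite /= in_itv/= lee_fin => /f1.
have := h; rewrite -[X in _ --> X]fineK; last exact: integrable_fin_num.
exact: fine_cvg.
Qed.

Definition dquot F h u := (F (u + h) - F u) / h.

Lemma dquot01 F h u : slope01 F -> 0 < h -> 0 <= dquot F h u <= 1.
Proof.
move=> sF h0; have uh : u <= u + h by rewrite lerDl ltW.
have /andP[a b] := sF _ _ uh.
apply/andP; split; first by rewrite divr_ge0// ltW.
by rewrite ler_pdivrMr// mul1r; lra.
Qed.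

Lemma dquot_measurable F h : slope01 F -> measurable_fun setT (dquot F h).
Proof.
move=> sF; apply: measurable_funM => //; apply: measurable_funB.
  apply: nondecreasing_measurable => // x y xy.
  have xyh : x + h <= y + h by rewrite lerD2r.
  by have := sF _ _ xyh; lra.
by apply: nondecreasing_measurable => // x y xy; have := sF _ _ xy; lra.
Qed.

Lemma dquot_sqr_int F h a b : slope01 F -> 0 < h ->
  mu.-integrable `[a, b] (EFin \o (fun u => dquot F h u ^+ 2)).
Proof.
move=> sF h0; apply: (@bounded_integrable _ _ _ 1).
  by apply: measurable_funX; apply: measurable_funS (dquot_measurable _ h sF).
move=> x _; have /andP[? ?] := dquot01 F h x sF h0.
by rewrite ger0_norm ?sqr_ge0// expr_le1.
Qed.

Lemma slope01_shift F h : slope01 F -> slope01 (fun u => F (u + h)).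
Proof.
move=> sF x y xy; have xyh : x + h <= y + h by rewrite lerD2r.
by have /andP[? ?] := sF _ _ xyh; apply/andP; split; lra.
Qed.

(** The integrand is the derivative of [P (u + h) - P u] for a primitive [P] of [F]. Starting [P] at
    -1 makes 0 an interior point for differentiation. *)
Lemma Rintegral_shift_diff F h : slope01 F -> 0 < h ->
  \int[mu]_(u in `[0, 1]) (F (u + h) - F u) =
  \int[mu]_(u in `[1, 1 + h]) F u - \int[mu]_(u in `[0, h]) F u.
Proof.
move=> sF h0; pose P (x : R) : R := \int[mu]_(t in `[-1, x]) F t.
have cF := slope01_continuous _ sF.
have Fi a b : mu.-integrable `[a, b] (EFin \o F).
  by apply: continuous_integrable => x _; exact: cF.
have dP (x : R) : 0 <= x -> is_derive x 1 P (F x).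
  move=> x0; have x1 : x < x + 1 by rewrite ltrDl.
  have x2 : -1 < x by lra.
  have [dP PE] : derivable P x 1 /\ derive1 P x = F x.
    exact: continuous_FTC1_closed x1 (Fi _ _) x2 (cF x).
  by apply: DeriveDef; [exact: dP|rewrite -derive1E; exact: PE].
have Pd a b : 0 <= a <= b -> P b - P a = \int[mu]_(t in `[a, b]) F t.
  move=> /andP[a0 ab]; rewrite /P (@Rintegral_split _ (-1) a b)//.
    by rewrite addrC addKr.
  by rewrite ab andbT; lra.
rewrite -!Pd; [|by rewrite lexx ltW|by rewrite ler01 lerDl ltW].
rewrite -[X in P X - P 0]add0r.
apply: (@FTC2_is_derive _ _ _ (fun u => P (u + h) - P u)) => // x /andP[x0 x1].
  apply: is_deriveB; last exact: dP.
  have dxh : is_derive (x + h) 1 P (F (x + h)) by apply: dP; lra.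
  have dh : is_derive x 1 (fun u : R => u + h) (1 + 0) by apply: is_deriveD.
  by have := @is_derive1_comp _ P (fun u => u + h) x _ _ dxh dh; rewrite addr0 mulr1.
by apply: cvgB; [exact: slope01_continuous (slope01_shift _ h sF) x|exact: cF].
Qed.

Section primitive.
Context {F f : R -> R} (mf : measurable_fun setT f) (f01 : forall u, 0 <= f u <= 1).

Let sqr_int a b : mu.-integrable `[a, b] (EFin \o (fun u => f u ^+ 2)).
Proof.
apply: (@bounded_integrable _ _ _ 1).
  by apply: measurable_funX; exact: measurable_funS mf.
move=> x _; have /andP[? ?] := f01 x.
by rewrite ger0_norm ?sqr_ge0// expr_le1.
Qed.

(** For negative [x] the interval is empty and the value 0, which keeps the slope bounds valid on
    the whole line. *)
Definition sqr_primitive x := \int[mu]_(u in `[0, x]) (f u ^+ 2).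

Lemma sqr_primitive_diff x y : 0 <= x <= y ->
  sqr_primitive y - sqr_primitive x = \int[mu]_(u in `[x, y]) (f u ^+ 2).
Proof.
move=> xy; rewrite /sqr_primitive (Rintegral_split 0 x y _ xy (sqr_int 0 y)).
by rewrite addrC addKr.
Qed.

Lemma sqr_primitive_slope01 : slope01 sqr_primitive.
Proof.
have sq a b : a <= b -> 0 <= \int[mu]_(u in `[a, b]) (f u ^+ 2) <= b - a.
  move=> ab; rewrite Rintegral_ge0 /=; last by move=> x _; exact: sqr_ge0.
  rewrite -[leRHS]mul1r -Rintegral_itv_cst//; apply: le_Rintegral => //.
    by apply: continuous_integrable => x _; exact: cvg_cst.
  by move=> x _; have /andP[? ?] := f01 x; rewrite expr_le1.
have neg z : z < 0 -> sqr_primitive z = 0.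
  by move=> z0; rewrite /sqr_primitive set_itv_ge ?Rintegral_set0// bnd_simp -ltNge.
move=> x y xy; have [x0|x0] := leP 0 x.
  by rewrite sqr_primitive_diff ?x0// sq.
rewrite (neg x)// subr0; have [y0|y0] := leP 0 y; last by rewrite neg; lra.
by have /andP[? ?] := sq _ _ y0; rewrite /sqr_primitive; apply/andP; split; lra.
Qed.

Hypothesis F1 : forall x, 1 <= x -> F x = F 1.
Hypothesis If : forall p q, p <= q -> \int[mu]_(u in `[p, q]) f u = F q - F p.

Let f_int a b : mu.-integrable `[a, b] (EFin \o f).
Proof.
apply: (@bounded_integrable _ _ _ 1); first exact: measurable_funS mf.
by move=> x _; have /andP[? ?] := f01 x; rewrite ger0_norm.
Qed.

(** Jensen's inequality: the quotient is the mean [s] of [f] over [[u, u + h]], and integrating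
    [0 <= (f - s)^2] compares its square with the mean of [f^2]. *)
Lemma dquot_sqr_le h u : 0 <= u -> 0 < h ->
  dquot F h u ^+ 2 <= h^-1 * (sqr_primitive (u + h) - sqr_primitive u).
Proof.
move=> u0 h0; have uh : u <= u + h by rewrite lerDl ltW.
rewrite sqr_primitive_diff ?u0// mulrC ler_pdivlMr//.
set s := dquot F h u.
have sE : s * h = F (u + h) - F u by rewrite /s /dquot mulfVK// gt_eqF.
have -> : s ^+ 2 * h = 2 * s * \int[mu]_(t in `[u, u + h]) f t -
    \int[mu]_(t in `[u, u + h]) (s ^+ 2).
  by rewrite If// Rintegral_itv_cst// -sE; ring.
have ci : mu.-integrable `[u, u + h] (EFin \o cst (s ^+ 2)).
  by apply: continuous_integrable => x _; exact: cvg_cst.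
have fi : mu.-integrable `[u, u + h] (EFin \o (fun t => 2 * s * f t)).
  by apply: RintegrableZ.
rewrite -RintegralZl// -RintegralB//; apply: le_Rintegral => //.
  exact: RintegrableB.
by move=> t _; have := sqr_ge0 (f t - s); lra.
Qed.

(** Beyond 1 the integral of [f] vanishes, and [f^2 <= f]. *)
Lemma sqr_primitive_const x : 1 <= x -> sqr_primitive x = sqr_primitive 1.
Proof.
move=> x1; apply/eqP; rewrite -subr_eq0 sqr_primitive_diff ?ler01//.
rewrite eq_le Rintegral_ge0 ?andbT; last by move=> t _; exact: sqr_ge0.
have <- : \int[mu]_(t in `[1, x]) f t = 0 by rewrite If// F1 ?subrr.
by apply: le_Rintegral => // t _; have /andP[? ?] := f01 t; rewrite expr2 ler_piMr.
Qed.

(** Integrating [dquot_sqr_le] leaves boundary integrals of the primitive [S]: the one over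
    [[1, 1 + h]] is at most [h * S 1], and the subtracted one is nonnegative. *)
Lemma dquot_energy_le h : slope01 F -> 0 < h ->
  \int[mu]_(u in `[0, 1]) (dquot F h u ^+ 2) <= sqr_primitive 1.
Proof.
move=> sF h0; have S1 := sqr_primitive_const; have qS := dquot_sqr_le.
have S0 t : 0 <= sqr_primitive t by apply: Rintegral_ge0 => x _; exact: sqr_ge0.
move: sqr_primitive sqr_primitive_slope01 S1 qS S0 => S sS S1 qS S0.
have cS := slope01_continuous _ sS.
have Si a b : mu.-integrable `[a, b] (EFin \o S).
  by apply: continuous_integrable => x _; exact: cS.
have Shi : mu.-integrable `[0, 1] (EFin \o (fun u => S (u + h) - S u)).
  apply: RintegrableB => //; apply: continuous_integrable => x _.
  by apply: slope01_continuous; exact: slope01_shift.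
have : \int[mu]_(u in `[0, 1]) (dquot F h u ^+ 2) <=
    \int[mu]_(u in `[0, 1]) (h^-1 * (S (u + h) - S u)).
  apply: le_Rintegral => //; first exact: dquot_sqr_int; first exact: RintegrableZ.
  by move=> u /=; rewrite in_itv/= => /andP[u0 _]; exact: qS.
move/le_trans; apply.
rewrite RintegralZl// mulrC ler_pdivrMr// Rintegral_shift_diff//.
have : \int[mu]_(t in `[1, 1 + h]) S t <= \int[mu]_(t in `[1, 1 + h]) S 1.
  apply: le_Rintegral => //.
    by apply: continuous_integrable => x _; exact: cvg_cst.
  by move=> t /=; rewrite in_itv/= => /andP[t1 _]; rewrite S1.
rewrite Rintegral_itv_cst; last by rewrite lerDl ltW.
have : 0 <= \int[mu]_(t in `[0, h]) S t by apply: Rintegral_ge0 => t _; exact: S0.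
lra.
Qed.

End primitive.
End quotient.

HB.lock Definition quot_energy {R : realType} (h : R) (C : R -> R -> R) (v : R) : R :=
  \int[@lebesgue_measure R]_(u in `[0, 1]%classic) (dquot (usection C v) h u ^+ 2).

(** * Lower semicontinuity of the energy and closedness of the region *)

Section closedness.
Context {R : realType}.
Local Notation mu := (@lebesgue_measure R).
Implicit Types (C D : R -> R -> R) (u v h x y e : R).

Lemma quot_energy01 h C v : 0 < h -> is_copula C -> 0 <= v <= 1 ->
  0 <= quot_energy h C v <= 1.
Proof.
move=> h0 cC v01; have sC := usection_slope01 _ _ cC v01; rewrite quot_energy.unlock.
rewrite Rintegral_ge0 /=; last by move=> u _; exact: sqr_ge0.
rewrite [leRHS](_ : _ = \int[mu]_(u in `[0, 1]) 1); last first.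
  by rewrite Rintegral_itv_cst//; ring.
apply: le_Rintegral => //; first exact: dquot_sqr_int.
  by apply: continuous_integrable => x _; exact: cvg_cst.
by move=> u _; have /andP[? ?] := dquot01 _ h u sC h0; rewrite expr_le1.
Qed.

Lemma quot_energy_le h C v : 0 < h -> is_copula C -> 0 <= v <= 1 ->
  quot_energy h C v <= d1_energy C v.
Proof.
move=> h0 cC v01; have sC := usection_slope01 _ _ cC v01.
have [x x0|x x1|f [mf f01 df If]] := @slope01_density R (usection C v) sC.
- by rewrite /usection !clamp_le0.
- by rewrite /usection !clamp_ge1.
rewrite (d1_energyE C v f mf df) quot_energy.unlock.
apply: (dquot_energy_le mf f01) => // x x1.
by rewrite /usection !clamp_ge1.
Qed.

Lemma quot_energy_mono h C v v' : 0 < h -> is_copula C ->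
  0 <= v -> v <= v' -> v' <= 1 -> quot_energy h C v <= quot_energy h C v'.
Proof.
move=> h0 cC v0 vv' v'1.
have v01 : 0 <= v <= 1 by rewrite v0 (le_trans vv').
have v'01 : 0 <= v' <= 1 by rewrite v'1 (le_trans v0).
have s := usection_slope01 _ _ cC v01; have s' := usection_slope01 _ _ cC v'01.
rewrite quot_energy.unlock; apply: le_Rintegral => //; [exact: dquot_sqr_int..|].
move=> u _; have /andP[? _] := dquot01 _ h u s h0; have /andP[? _] := dquot01 _ h u s' h0.
rewrite ler_sqr ?nnegrE// ler_pM2r ?invr_gt0// /usection.
have uh : u <= u + h by rewrite lerDl ltW.
have /andP[a0 a1] := clamp01 u; have /andP[b0 b1] := clamp01 (u + h).
have /andP[cab _] := clamp_slope01 _ _ uh; rewrite subr_ge0 in cab.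
by have := cC.2 _ _ _ _ a0 cab b1 v0 vv' v'1; lra.
Qed.

Lemma quot_energy_measurable h C : 0 < h -> is_copula C ->
  measurable_fun (`[0, 1] : set R) (quot_energy h C).
Proof.
move=> h0 cC; apply: nondecreasing_in_measurable => x y x0 xy y1.
exact: quot_energy_mono.
Qed.

Lemma quot_energy_int h C : 0 < h -> is_copula C ->
  mu.-integrable `[0, 1] (EFin \o quot_energy h C).
Proof.
move=> h0 cC; apply: (@bounded_integrable _ _ _ 1); first exact: quot_energy_measurable.
by move=> v v01; have /andP[? ?] := quot_energy01 _ _ _ h0 cC v01; rewrite ger0_norm.
Qed.

Lemma quot_energy_cvg C v : is_copula C -> 0 <= v <= 1 ->
  quot_energy n.+1%:R^-1 C v @[n --> \oo] --> d1_energy C v.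
Proof.
move=> cC v01; have s := usection_slope01 _ _ cC v01.
have [f df] := density_ex _ _ cC v01; rewrite (density_energy df) quot_energy.unlock.
have n0 n : 0 < n.+1%:R^-1 :> R by rewrite invr_gt0.
case: df => mf f01 f' _; apply: Rintegral_bounded_cvg.
- by move=> n; apply: measurable_funX; apply: measurable_funS (dquot_measurable _ _ s).
- by apply: measurable_funX; exact: measurable_funS mf.
- move=> n x _; have /andP[? ?] := dquot01 _ n.+1%:R^-1 x s (n0 n).
  by rewrite ger0_norm ?sqr_ge0// expr_le1.
apply: aeS f' => x /is_derive_seq fx _; rewrite [X in _ --> X]expr2.
under eq_fun do rewrite /dquot invrK mulrC expr2.
exact: cvgM.
Qed.

Lemma quot_energy_integral_cvg C : is_copula C ->
  \int[mu]_(v in `[0, 1]) quot_energy n.+1%:R^-1 C v @[n --> \oo] --> energy C.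
Proof.
move=> cC; have n0 n : 0 < n.+1%:R^-1 :> R by rewrite invr_gt0.
rewrite energy.unlock; apply: Rintegral_bounded_cvg.
- by move=> n; exact: quot_energy_measurable.
- by apply: nondecreasing_in_measurable => x y x0 xy y1; exact: d1_energy_mono.
- by move=> n v v01; have /andP[? ?] := quot_energy01 _ _ _ (n0 n) cC v01; rewrite ger0_norm.
- by apply: aeW => v v01; exact: quot_energy_cvg.
Qed.

Definition copula_close e C D :=
  forall u v, 0 <= u <= 1 -> 0 <= v <= 1 -> `|C u v - D u v| <= e.

(** The quotients differ by at most [2 e / h]; as both lie in [0, 1], squaring at most doubles
    this. *)
Lemma quot_energy_close h e C D v : 0 < h -> is_copula C -> is_copula D ->
  copula_close e C D -> 0 <= v <= 1 ->
  quot_energy h C v <= quot_energy h D v + 4 * e / h.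
Proof.
move=> h0 cC cD CD v01.
have s := usection_slope01 _ _ cC v01; have s' := usection_slope01 _ _ cD v01.
rewrite quot_energy.unlock -[4 * e / h]mulr1 -[X in _ * X]subr0.
rewrite -Rintegral_itv_cst//.
have ci : mu.-integrable `[0, 1] (EFin \o cst (4 * e / h)).
  by apply: continuous_integrable => x _; exact: cvg_cst.
have qi := dquot_sqr_int _ h 0 1 s' h0.
rewrite -RintegralD//; apply: le_Rintegral => //; first exact: dquot_sqr_int.
  exact: RintegrableD.
move=> u _; have /andP[a0 a1] := dquot01 _ h u s h0; have /andP[b0 b1] := dquot01 _ h u s' h0.
have : dquot (usection C v) h u - dquot (usection D v) h u <= 2 * e / h.
  rewrite /dquot -mulrBl ler_pM2r ?invr_gt0// /usection.
  have := CD _ _ (clamp01 (u + h)) v01; have := CD _ _ (clamp01 u) v01.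
  by rewrite !ler_norml; lra.
have : 0 <= 2 * e / h.
  have e0 : 0 <= e.
    by apply: le_trans (CD 0 0 _ _); rewrite ?normr_ge0 ?lexx ?ler01.
  by apply: divr_ge0; [exact: mulr_ge0|exact: ltW].
have -> : 4 * e / h = 2 * (2 * e / h) by ring.
move: (dquot _ h u) (dquot _ h u) (2 * e / h) a0 a1 b0 b1 => a b c *; nra.
Qed.

(** For fixed [h] the quotient energy of [C] is at most the energy of a nearby [D] up to an error
    proportional to the distance; that distance tends to 0 before [h] does. *)
Lemma energy_lsc C x : is_copula C ->
  (forall e, 0 < e -> exists D, [/\ is_copula D, copula_close e C D &
     energy D <= x + e]) ->
  energy C <= x.
Proof.
move=> cC CD; apply: cvgr_to_le (quot_energy_integral_cvg C cC) _.
apply: nearW => n; apply/ler_addgt0Pr => e e0.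
set h : R := n.+1%:R^-1; have h0 : 0 < h by rewrite invr_gt0.
(* Chosen so that the energy slack [d] and the closeness cost [4 d / h] add up to [e]. *)
pose d := e / (1 + 4 / h).
have h1 : 0 < 1 + 4 / h by rewrite addr_gt0// divr_gt0.
have d0 : 0 < d by rewrite divr_gt0.
have [D [cD close ED]] := CD d d0.
have Di := quot_energy_int h D h0 cD; have Ci := quot_energy_int h C h0 cC.
have ci : mu.-integrable `[0, 1] (EFin \o cst (4 * d / h)).
  by apply: continuous_integrable => t _; exact: cvg_cst.
have : \int[mu]_(v in `[0, 1]) quot_energy h C v <=
    \int[mu]_(v in `[0, 1]) (d1_energy D v + 4 * d / h).
  apply: le_Rintegral => //; first by apply: RintegrableD => //; exact: d1_energy_int.
  move=> v /=; rewrite in_itv/= => v01.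
  apply: le_trans (quot_energy_close _ _ _ _ _ h0 cC cD close v01) _.
  by rewrite lerD2r quot_energy_le.
rewrite RintegralD//; last exact: d1_energy_int.
move/le_trans; apply; rewrite Rintegral_itv_cst// subr0 mulr1.
move: ED; rewrite energy.unlock => ED.
apply: (@le_trans _ _ (x + d + 4 * d / h)); first by rewrite lerD2r.
rewrite -addrA lerD2l; have -> : d + 4 * d / h = d * (1 + 4 / h) by ring.
by rewrite /d mulfVK ?gt_eqF.
Qed.

Lemma psi_close e C D : is_copula C -> is_copula D -> copula_close e C D ->
  `|psi C - psi D| <= 6 * e.
Proof.
move=> cC cD CD; rewrite /psi.
have -> : 6 * (\int[mu]_(u in `[0, 1]) C u u) - 2 -
    (6 * (\int[mu]_(u in `[0, 1]) D u u) - 2) =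
    6 * \int[mu]_(u in `[0, 1]) (C u u - D u u).
  by rewrite RintegralB//; [ring|exact: diag_int..].
rewrite normrM ger0_norm// ler_pM2l//.
have i : mu.-integrable `[0, 1] (EFin \o (fun u => C u u - D u u)).
  by apply: RintegrableB => //; exact: diag_int.
apply: le_trans (le_normr_Rintegral _ _) _ => //.
have -> : e = \int[mu]_(u in `[0, 1]) e by rewrite Rintegral_itv_cst//; ring.
apply: le_Rintegral => //.
- exact: integrable_norm.
- by apply: continuous_integrable => t _; exact: cvg_cst.
- by move=> u /=; rewrite in_itv/= => u01; exact: CD.
Qed.

(** Compactness gives a cluster point of the image, and an ultrafilter converges to its cluster
    points. *)
Lemma ultra_bounded_cvg (T : Type) (G : set_system T) (phi : T -> R) :
  UltraFilter G -> G [set t | 0 <= phi t <= 1] -> cvg (phi @ G).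
Proof.
move=> UG Gphi.
have [|l [_ cl]] := @segment_compact R 0 1 (phi @ G) _.
  change (G (phi @^-1` `[0, 1]%classic)).
  by apply: filterS Gphi => t; rewrite /= in_itv.
apply/cvg_ex; exists l => B Bl.
have [//|nB] := in_ultra_setVsetC (phi @^-1` B) UG.
by have [z [? ?]] := cl (~` B) B nB Bl.
Qed.

Lemma copula_slope_uv C u u' v v' : is_copula C ->
  0 <= u' -> u' <= u -> u <= 1 -> 0 <= v' -> v' <= v -> v <= 1 ->
  0 <= C u v - C u' v' <= (u - u') + (v - v').
Proof.
move=> cC u'0 uu' u1 v'0 vv' v1.
have u'01 : 0 <= u' <= 1 by rewrite u'0 (le_trans uu').
have v01 : 0 <= v <= 1 by rewrite v1 (le_trans v'0).
have /andP[? ?] := copula_slope_u _ _ _ _ cC u'0 uu' u1 v01.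
have /andP[? ?] := copula_slope_v _ _ _ _ cC v'0 vv' v1 u'01.
by apply/andP; split; lra.
Qed.

Lemma grid_point (N : nat) u : (0 < N)%N -> 0 <= u <= 1 ->
  exists i : 'I_N.+1, let u' := i%:R / N%:R in [/\ 0 <= u', u' <= u & u - u' <= N%:R^-1].
Proof.
move=> N0 /andP[u0 u1]; have N0' : 0 < N%:R :> R by rewrite ltr0n.
have /andP[t1 t2] := Num.Theory.truncn_itv (mulr_ge0 u0 (ltW N0')).
(* The index [N] is attained at [u = 1], hence [N + 1] grid points. *)
have tN : (Num.truncn (u * N%:R) < N.+1)%N.
  rewrite ltnS -(ler_nat R); apply: le_trans t1 _.
  by rewrite -[leRHS]mul1r ler_pM2r.
exists (Ordinal tN) => /=; split.
- by rewrite divr_ge0.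
- by rewrite ler_pdivrMr.
- have : u <= (Num.truncn (u * N%:R)).+1%:R / N%:R by rewrite ler_pdivlMr// ltW.
  by rewrite -natr1 mulrDl mul1r; lra.
Qed.

(** * Ultrafilter limits of copulas *)

Section ultralimit.
Context (G : set_system (R -> R -> R)) {UG : UltraFilter G}.
Hypothesis Gcop : G (@is_copula R).

(** Meaningful on the unit square only; elsewhere the limit may fail to exist and [lim] returns a
    default. *)
Definition ulim u v : R := lim ((fun C => C u v) @ G).

Lemma ulim_cvg u v : 0 <= u <= 1 -> 0 <= v <= 1 ->
  (fun C : R -> R -> R => C u v) @ G --> ulim u v.
Proof.
move=> u01 v01; apply: ultra_bounded_cvg; apply: filterS Gcop => C cC /=.
have [? _ ? _] := copula_bounds _ _ _ cC u01 v01.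
by case/andP: u01 => _ u1; apply/andP; split => //; exact: le_trans u1.
Qed.

Lemma ulim_eq u v c : 0 <= u <= 1 -> 0 <= v <= 1 ->
  (forall C, is_copula C -> C u v = c) -> ulim u v = c.
Proof.
move=> u01 v01 H; apply/le_anti/andP; split.
  by apply: cvgr_to_le (ulim_cvg _ _ u01 v01) _; apply: filterS Gcop => C /H ->.
by apply: cvgr_to_ge (ulim_cvg _ _ u01 v01) _; apply: filterS Gcop => C /H ->.
Qed.

Lemma ulim_copula : is_copula ulim.
Proof.
have i0 : 0 <= (0 : R) <= 1 by rewrite lexx ler01.
have i1 : 0 <= (1 : R) <= 1 by rewrite lexx ler01.
split => [u u01|u1 u2 v1 v2 h1 h2 h3 h4 h5 h6].
  by split; [|split; [|split]]; apply: ulim_eq => // C cC;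
    have [? [? [? ?]]] := cC.1 _ u01.
have iu1 : 0 <= u1 <= 1 by rewrite h1 (le_trans h2).
have iu2 : 0 <= u2 <= 1 by rewrite h3 (le_trans h1).
have iv1 : 0 <= v1 <= 1 by rewrite h4 (le_trans h5).
have iv2 : 0 <= v2 <= 1 by rewrite h6 (le_trans h4).
have c : (fun C : R -> R -> R => C u2 v2 - C u2 v1 - C u1 v2 + C u1 v1) @ G -->
    ulim u2 v2 - ulim u2 v1 - ulim u1 v2 + ulim u1 v1.
  by apply: cvgD; [apply: cvgB; [apply: cvgB|]|]; exact: ulim_cvg.
by apply: cvgr_to_ge c _; apply: filterS Gcop => C cC; exact: cC.2.
Qed.

(* Copulas are equi-Lipschitz, so pointwise convergence on a finite grid is
   uniform convergence up to the mesh. *)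
Lemma ulim_close e : 0 < e -> G (copula_close e ulim).
Proof.
(* Moving to a grid point changes both copulas by an amount in [[0, 2 / N]], so the discrepancy is
   at most [2 / N <= e / 2]; the grid values account for the other half. *)
move=> e0; pose N := (Num.truncn (4 / e)).+1.
have N0 : 0 < N%:R :> R by rewrite ltr0n.
have Ne : 2 * N%:R^-1 <= e / 2.
  have /andP[_ /ltW] := Num.Theory.truncn_itv (divr_ge0 (ler0n R 4) (ltW e0)).
  rewrite -/N ler_pdivrMr// => h.
  by rewrite ler_pdivrMr// mulrAC ler_pdivlMr//; lra.
have grid (ij : 'I_N.+1 * 'I_N.+1) : \forall C \near G,
    `|ulim (ij.1%:R / N%:R) (ij.2%:R / N%:R) -
      C (ij.1%:R / N%:R) (ij.2%:R / N%:R)| <= e / 2.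
  have g01 (i : 'I_N.+1) : 0 <= (i%:R / N%:R : R) <= 1.
    rewrite divr_ge0//= ler_pdivrMr// mul1r ler_nat -ltnS; exact: ltn_ord.
  have /cvgrPdist_le := ulim_cvg _ _ (g01 ij.1) (g01 ij.2).
  by apply; rewrite divr_gt0.
have gridG : \forall C \near G, forall ij : 'I_N.+1 * 'I_N.+1,
    `|ulim (ij.1%:R / N%:R) (ij.2%:R / N%:R) -
      C (ij.1%:R / N%:R) (ij.2%:R / N%:R)| <= e / 2 by exact: filter_forall.
apply: filterS2 Gcop gridG => C cC gridC u v u01 v01.
have [i [u'0 u'u uu']] := grid_point N u isT u01.
have [j [v'0 v'v vv']] := grid_point N v isT v01.
have := gridC (i, j) => /=.
case/andP: u01 => _ u1; case/andP: v01 => _ v1.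
have /andP[? ?] := copula_slope_uv _ _ _ _ _ cC u'0 u'u u1 v'0 v'v v1.
have /andP[? ?] := copula_slope_uv _ _ _ _ _ ulim_copula u'0 u'u u1 v'0 v'v v1.
by rewrite !ler_norml => /andP[? ?]; apply/andP; split; lra.
Qed.

End ultralimit.

(** An ultrafilter of copulas whose points approach [(x, y)] has a limit [L] with [psi L = y]. Only
    [xi L <= x] survives, because [xi] may drop in the limit; [region_ray] makes up the
    difference. *)
Lemma region_closed : closed (@xi_psi_region R : set (R * R)%type).
Proof.
move=> [x y] cl.
pose B e := [set C : R -> R -> R |
  [/\ is_copula C, `|x - xi C| < e & `|y - psi C| < e]].
have FF : ProperFilter (filter_from [set e : R | 0 < e] B).
  apply: filter_from_proper; first apply: filter_from_filter.
  - by exists 1 => /=.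
  - move=> d e d0 e0; exists (Num.min d e); first by rewrite /= lt_min d0.
    by move=> C [cC]; rewrite !lt_min => /andP[? ?] /andP[? ?].
  - move=> e e0; have [p [[C [cC ->]] [h1 h2]]] := cl _ (nbhsx_ballx (x, y) e e0).
    by exists C.
have [G [UG FG]] := ultraFilterLemma FF.
have Gcop : G (@is_copula R) by apply: FG; exists 1 => //= C [].
pose L := ulim G; have cL : is_copula L by exact: ulim_copula.
have ex e : 0 < e -> exists D,
    [/\ is_copula D, copula_close e L D, `|x - xi D| < e & `|y - psi D| < e].
  move=> e0; have GB : G (B e) by apply: FG; exists e.
  have [D [[cD ? ?] ?]] := filter_ex (filterI GB (ulim_close G Gcop e e0)).
  by exists D.
have pL : psi L = y.
  apply/eqP; rewrite -subr_eq0 -normr_le0; apply/ler_addgt0Pr => e e0.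
  (* Six sevenths are spent by [psi_close] and one by the distance from [psi D] to [y]. *)
  have e7 : 0 < e / 7 by rewrite divr_gt0.
  have [D [cD LD _ yD]] := ex _ e7.
  have := psi_close _ _ _ cL cD LD; move: yD; rewrite add0r.
  move: (psi L) (psi D) => a b.
  by rewrite ltr_norml !ler_norml => /andP[? ?] /andP[? ?]; apply/andP; split; lra.
have xL : xi L <= x.
  rewrite xiE; suff : energy L <= (x + 2) / 6 by lra.
  apply: energy_lsc => // e /ex[D [cD LD xD _]]; exists D; split => //.
  by move: xD; rewrite xiE ltr_norml => /andP[? ?]; lra.
have x1 : x <= 1.
  apply/ler_addgt0Pr => e /ex[D [cD _ + _]]; have := xi_le1 D cD.
  by move: (xi D) => a; rewrite ltr_norml => ? /andP[? ?]; lra.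
by rewrite -pL; apply: region_ray => //; rewrite xL.
Qed.

End closedness.

Theorem mainTheorem7 (R : realType) :
  (forall p, @xi_psi_region R p -> 0 <= p.1 <= 1 /\ - (1 / 2) <= p.2 <= 1) /\
  convex_set (@xi_psi_region R : set (convex_lmodType (R * R)%type)) /\
  closed (@xi_psi_region R : set (R * R)%type) /\
  (forall x y, @xi_psi_region R (x, y) ->
     y <= Num.sqrt x /\
     (y <= 0 ->
        exists m : R, (0 <= m <= 2 /\ mu_cubic y m = 0) /\
          (forall m' : R, 0 <= m' <= 2 -> mu_cubic y m' = 0 -> m' = m) /\
          Xi m <= x)).
Proof.
split; first by move=> _ [C [cC ->]] /=; rewrite xi_ge0 ?xi_le1 ?psi_ge ?psi_le1.
split; first exact: region_convex.
split; first exact: region_closed.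
move=> x y [C [cC [-> ->]]]; split; first exact: psi_le_sqrt_xi.
move=> y0; have [|m [m02 mE] uniq_m] := mu_cubic_root (psi C).
  by rewrite psi_ge.
by exists m; split=> //; split=> //; exact: xi_lower_bound.
Qed.
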